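(* Let $\Lambda$ be a finite lattice, $N\ge1$, $\beta>0$, and let $s=(\ell_1,\dots,\ell_n)$ be a string. For lattice Yang–Mills theory with gauge group $SU(N)$, $$\langle W_s\rangle_{\Lambda,\beta}=Z_{\Lambda,\beta}^{-1}\sum_{(\mathcal M,\phi)\in\mathrm{FEPE}_{\mathrm{SU}}(s)}\frac{\beta^{\mathrm{area}(\mathcal M,\phi)}}{(\phi^{-1})!}\prod_{e\in E_\Lambda^+}\overline{\mathrm{Wg}}^{\mathrm{SU}}_N(\mu_e(\phi))\,N^{\chi(\mathcal M)-n}.$$ For lattice Yang–Mills theory with gauge group $SO(N)$, $$\langle W_s\rangle_{\Lambda,\beta}=Z_{\Lambda,\beta}^{-1}\sum_{(\mathcal M,\phi)\in\mathrm{FEPE}_{\mathrm{SO}}(s)}\frac{\beta^{\mathrm{area}(\mathcal M,\phi)}}{(\phi^{-1})!}\prod_{e\in E_\Lambda^+}\overline{\mathrm{Wg}}^{\mathrm{SO}}_N(\mu_e(\phi))\,N^{\chi(\mathcal M)-n}.$$ The sums converge absolutely in the following sense: for $G\in\{\mathrm{SU},\mathrm{SO}\}$, $$\sum_{K:\mathcal P\to\mathbb N}\Big|\sum_{(\mathcal M,\phi)\in\mathrm{FEPE}_G(s,K)}\frac{\beta^{\mathrm{area}(\mathcal M,\phi)}}{(\phi^{-1})!}\prod_{e\in E_\Lambda^+}\overline{\mathrm{Wg}}^{G}_N(\mu_e(\phi))\,N^{\chi(\mathcal M)-n}\Big|<\infty.$$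
   Context: Lattice Yang–Mills with gauge group $\mathcal G=SU(N)$ or $SO(N)$: $\Lambda$ is a finite graph, $E_\Lambda^+$ contains one orientation of each edge. To each $e\in E_\Lambda^+$ is assigned $Q_e\in\mathcal G$, with $Q_{e^{-1}}=Q_e^{-1}$; for a path $p=(e_1,\dots,e_k)$, $Q_p=Q_{e_1}\cdots Q_{e_k}$. A loop is a (nonempty) directed closed path up to cyclic reordering. $\mathcal P$ is a finite set of loops (plaquettes) closed under orientation reversal (usually directed unit squares). The measure is $Z_{\Lambda,\beta}^{-1}\prod_{p\in\mathcal P}\exp(N\beta\,\mathrm{Tr}(Q_p))\prod_{e\in E_\Lambda^+}dQ_e$, $dQ_e$ normalized Haar measure on $\mathcal G$, $Z_{\Lambda,\beta}$ the normalizing constant. A string $s=(\ell_1,\dots,\ell_n)$ is a finite collection of loops; $W_s(Q)=\prod_i\frac1N\mathrm{Tr}(Q_{\ell_i})$ and $\langle W_s\rangle_{\Lambda,\beta}$ is its expectation. Matchings and $\rho_+$: $\mathfrak M(k)$ is the set of perfect matchings of the $2k$ vertices of $k$ strands (each strand having a left and a right vertex). $\mathfrak M(a,b)\subset\mathfrak M(a+b)$ is the set of matchings such that every same-side pair joins one of the strands $1,\dots,a$ with one of the strands $a+1,\dots,a+b$, and every left–right pair joins vertices of two strands both in $\{1,\dots,a\}$ or both in $\{a+1,\dots,a+b\}$ (possibly the same strand). $\mathcal B_k$ and $\mathcal B_{a,b}$ are the spaces of complex functions on $\mathfrak M(k)$, $\mathfrak M(a,b)$ (Brauer and walled Brauer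 algebras with parameter $N$; product of diagrams by side-by-side concatenation, each closed loop giving a factor $N$). $\rho_+(\pi)\in\mathrm{End}((\mathbb C^N)^{\otimes k})$ has $(\mathbf i,\mathbf j)$ entry $1$ if, putting $i_r$ on left vertex $r$ and $j_r$ on right vertex $r$, all pairs of $\pi$ carry equal indices, and $0$ otherwise; $\rho_+$ is extended linearly. Weingarten elements: for all $a,b,k\ge0$ fix elements $\mathrm{Wg}_N^{\mathrm{SU}}\in\mathcal B_{a,b}$ and $\mathrm{Wg}_N^{\mathrm{SO}}\in\mathcal B_k$ (which exist) with $\mathbb E[U^{\otimes a}\otimes\overline U^{\otimes b}]=\rho_+(\mathrm{Wg}_N^{\mathrm{SU}})$ for Haar $U\in SU(N)$, $\mathbb E[O^{\otimes k}]=\rho_+(\mathrm{Wg}_N^{\mathrm{SO}})$ for Haar $O\in SO(N)$, invariant under reflection $\pi\mapsto\pi^T$ (exchange of left and right) and under conjugation by $S_a\times S_b$ (resp. $S_k$), i.e. under permutation of strands. Maps: given $K:\mathcal P\to\mathbb N$, let $\mathbf\Gamma(s,K)$ be the collection of words in the letters $E_\Lambda^+$ consisting of $\ell_1,\dots,\ell_n$ and $K(p)$ copies of each $p\in\mathcal P$. Let $n_e(+),n_e(-)$ be the numbers of occurrences of $e$, $e^{-1}$. For every letter occurrence take a strand with left and right vertex; occurrences of $e$ are traversed left to right and those of $e^{-1}$ right to left; label strands at occurrences of $e$ by $1,\dots,n_e(+)$ and those of $e^{-1}$ by $n_e(+)+1,\dots,n_e(+)+n_e(-)$. For each family $(\pi_e)_{e\in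 E_\Lambda^+}$ with $\pi_e\in\mathfrak M(n_e(+),n_e(-))$ (SU case), resp. $\pi_e\in\mathfrak M(n_e(+)+n_e(-))$ (SO case), build a map: yellow faces are polygons, one per word, whose boundary edges are the strands of the word in cyclic order (end vertex of each strand identified with the start vertex of the next); blue faces at $e$ are the polygons obtained from the closed cycles formed alternately by strands of $e$ and pairs of $\pi_e$, on contracting the pairs of $\pi_e$ to points. Each strand is on one yellow and one blue face, and faces are glued along common strands. Delete the $n$ yellow faces of $\ell_1,\dots,\ell_n$ to get $\mathcal M$, and let $\phi$ send each strand to its lattice edge (hence each remaining yellow face to a plaquette). $\mathrm{FEPE}_{\mathrm{SU}}(s,K)$, $\mathrm{FEPE}_{\mathrm{SO}}(s,K)$ are the sets of pairs $(\mathcal M,\phi)$ (flexible edge-plaquette embeddings) so obtained, one for each choice of $(\pi_e)_e$ (labelled objects), and $\mathrm{FEPE}_G(s)=\bigsqcup_K\mathrm{FEPE}_G(s,K)$. For such $(\mathcal M,\phi)$: $\mathrm{area}(\mathcal M,\phi)=\sum_pK(p)$, $(\phi^{-1})!=\prod_pK(p)!$, $\chi(\mathcal M)$ is the Euler characteristic (vertices minus edges plus faces), $\mu_e(\phi)$ is the profile of blue faces at $e$. With $\#\mathrm{cycles}(\pi)$ the number of blue faces produced by $\pi$, $\overline{\mathrm{Wg}}^{\mathrm{SU}}_N(\pi)=N^{a+b-\#\mathrm{cycles}(\pi)}\mathrm{Wg}^{\mathrm{SU}}_N(\pi)$ for $\pi\in\mathfrak M(a,b)$ and $\overline{\mathrm{Wg}}^{\mathrm{SO}}_N(\pi)=N^{k-\#\mathrm{cycles}(\pi)}\mathrm{Wg}^{\mathrm{SO}}_N(\pi)$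 for $\pi\in\mathfrak M(k)$; $\overline{\mathrm{Wg}}^{G}_N(\mu_e(\phi))$ means $\overline{\mathrm{Wg}}^{G}_N(\pi_e)$. *)

(* Defs.v *)
From HB Require Import structures.
From mathcomp Require Import all_boot all_order all_algebra perm spectral.
From mathcomp Require Import finmap generic_quotient complex.
From mathcomp Require Import all_classical all_reals all_analysis.

Set Implicit Arguments.
Unset Strict Implicit.
Unset Printing Implicit Defensive.

Import Order.TTheory GRing.Theory Num.Theory.
Import numFieldNormedType.Exports.

Local Open Scope classical_set_scope.
Local Open Scope ring_scope.

Section ComplexAnalysis.
Variable R : realType.

Definition cexp (z : R[i]) : R[i] :=
  (expR (complex.Re z))%:C%C * Complex (cos (complex.Im z)) (sin (complex.Im z)).

Definition cintegral d (T : measurableType d) (mu : {measure set T -> \bar R})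
    (f : T -> R[i]) : R[i] :=
  Complex (\int[mu]_x complex.Re (f x)) (\int[mu]_x complex.Im (f x)).

(* Sum of an absolutely summable family; like [fine], it takes a junk value on
   families that are not absolutely summable. *)
Definition rsum (I : choiceType) (f : I -> R) : R :=
  fine (\esum_(i in [set: I]) ((EFin \o f)^\+ i)%E) -
  fine (\esum_(i in [set: I]) ((EFin \o f)^\- i)%E).

Definition csum (I : choiceType) (f : I -> R[i]) : R[i] :=
  Complex (rsum (fun i => complex.Re (f i))) (rsum (fun i => complex.Im (f i))).

Definition cabs_summable (I : choiceType) (f : I -> R[i]) : Prop :=
  (\esum_(i in [set: I]) (Normc.normc (f i))%:E < +oo)%E.

End ComplexAnalysis.

Section ProductMeasure.
Context d (T : measurableType d).

Definition tuple_cons n (x : T * n.-tuple T) : n.+1.-tuple T :=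
  [tuple of x.1 :: x.2].

Lemma measurable_tuple_cons n : measurable_fun [set: T * n.-tuple T] (@tuple_cons n).
Proof. exact: (measurable_cons measurable_fst measurable_snd). Qed.

HB.instance Definition _ n :=
  isMeasurableFun.Build _ _ _ _ (@tuple_cons n) (@measurable_tuple_cons n).

Variables (R : realType) (mu : probability T R).

Fixpoint tuple_prob n : probability (n.-tuple T) R :=
  if n is m.+1 then distribution (mu \x tuple_prob m)%E (@tuple_cons m)
  else \d_([tuple] : 0.-tuple T).

Lemma measurable_tuple_rect n (A : 'I_n -> set T) : (forall i, measurable (A i)) ->
  measurable [set t : n.-tuple T | forall i, A i (tnth t i)].
Proof.
move=> mA; rewrite (_ : [set t | _] =
    \big[setI/setT]_(i <- index_enum 'I_n) ((@tnth n T)^~ i @^-1` A i)); last first.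
  rewrite -bigcap_seq; apply/seteqP; split=> [t At i _|t At i]; first exact: At.
  by apply: At; rewrite /= mem_index_enum.
elim/big_ind: _ => [||i _]; [exact: measurableT|exact: measurableI|].
by rewrite -[X in measurable X]setTI; exact: (@measurable_tnth _ T n i).
Qed.

Lemma tuple_probE n (A : 'I_n -> set T) : (forall i, measurable (A i)) ->
  tuple_prob n [set t | forall i, A i (tnth t i)] = (\prod_(i < n) mu (A i))%E.
Proof.
elim: n A => [|n IHn] A mA.
  rewrite big_ord0 /= diracE mem_set//=; by case.
rewrite big_ord_recl -IHn//.
have mB := measurable_tuple_rect (fun i => mA (lift ord0 i)).
rewrite -product_measure1E//.
rewrite [LHS]/= /distribution /pushforward; congr ((_ \x _)%E _).
apply/seteqP; split=> -[x t] /= => [At|[A0 At] i].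
  by split=> [|i]; [exact: (At ord0)|rewrite -(tnthS x); exact: At].
have [j ->|->] := unliftP ord0 i; last exact: A0.
by rewrite tnthS; exact: At.
Qed.

End ProductMeasure.

Variant gauge_kind := SU | SO.

Section GaugeGroup.
Variables (R : realType) (G : gauge_kind) (N : nat).

(* SO(N) is realised as the real matrices inside the complex ones, so that both
   groups share one representation. *)
Definition in_gauge (U : 'M[R[i]]_N) : bool :=
  match G with
  | SU => (U \is unitarymx) && (\det U == 1)
  | SO => [&& U \is a mxOver Num.real, U *m U^T == 1%:M & \det U == 1]
  end.

Lemma in_gauge1 : in_gauge 1%:M.
Proof.
rewrite /in_gauge; case: G.
  by rewrite det1 eqxx andbT; apply/unitarymxP; rewrite mul1mx trmx1 map_mx1.
by rewrite det1 trmx1 mulmx1 !eqxx !andbT; apply: mxOver_scalar; rewrite ?rpred0.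
Qed.

Lemma in_gaugeM U V : in_gauge U -> in_gauge V -> in_gauge (U *m V).
Proof.
rewrite /in_gauge; case: G.
  move=> /andP[UU /eqP dU] /andP[VV /eqP dV].
  by rewrite mul_unitarymx// det_mulmx dU dV mulr1 eqxx.
move=> /and3P[UR /eqP UU /eqP dU] /and3P[VR /eqP VV /eqP dV].
rewrite det_mulmx dU dV mulr1 eqxx mxOverM//= andbT.
by rewrite trmx_mul -mulmxA (mulmxA V) VV mul1mx UU.
Qed.

Definition gauge_elt := {U : 'M[R[i]]_N | in_gauge U}.

HB.instance Definition _ := Choice.on gauge_elt.
HB.instance Definition _ := isPointed.Build gauge_elt (Sub 1%:M in_gauge1).

Definition gauge_coords (U : gauge_elt) : 'M[R]_N * 'M[R]_N :=
  (map_mx (@complex.Re R) (val U), map_mx (@complex.Im R) (val U)).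

(* The topology induced by M_N(C) = M_N(R) x M_N(R). *)
Definition gauge_open : set (set gauge_elt) :=
  [set gauge_coords @^-1` O | O in [set O | open O]].

Definition gauge_group := g_sigma_algebraType gauge_open.

Definition gmx (U : gauge_group) : 'M[R[i]]_N := sval U.
Definition gmul (U V : gauge_group) : gauge_group :=
  (Sub _ (in_gaugeM (svalP U) (svalP V)) : gauge_elt).

Definition is_haar (mu : probability gauge_group R) : Prop :=
  forall (U : gauge_group) (A : set gauge_group),
    measurable A -> mu [set gmul U V | V in A] = mu A.

End GaugeGroup.

(* A matching is given by its partner function; (r, false) is the left and
   (r, true) the right vertex of strand r. *)
Definition matching k :=
  {m : {ffun 'I_k * bool -> 'I_k * bool}
     | [forall x, (m x != x) && (m (m x) == x)]}.

Definition partner k (m : matching k) : 'I_k * bool -> 'I_k * bool := val m.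

Definition walled a b (m : matching (a + b)) : bool :=
  [forall x, let y := partner m x in
     if x.2 == y.2 then (x.1 < a)%N != (y.1 < a)%N
     else (x.1 < a)%N == (y.1 < a)%N].

Definition walled_matching a b := {m : matching (a + b) | walled m}.

Definition flip (T : Type) (x : T * bool) : T * bool := (x.1, ~~ x.2).

Definition is_transpose k (m m' : matching k) : Prop :=
  forall x, partner m' (flip x) = flip (partner m x).

Definition is_conjugate k (g : 'S_k) (m m' : matching k) : Prop :=
  forall x, partner m' (g x.1, x.2) = (g (partner m x).1, (partner m x).2).

(* The polygons formed alternately by strands and pairs of the matching. *)
Definition cycles k (m : matching k) : {set {set 'I_k * bool}} :=
  equivalence_partition
    (connect (fun x y => (y == flip x) || (y == partner m x))) [set: 'I_k * bool].

Section Weingarten.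
Variables (R : realType) (N : nat).

Definition rho k (m : matching k) (i j : {ffun 'I_k -> 'I_N}) : R[i] :=
  let label (x : 'I_k * bool) := if x.2 then j x.1 else i x.1 in
  [forall x, label x == label (partner m x)]%:R.

Definition rho_walled a b (f : walled_matching a b -> R[i])
    (i j : {ffun 'I_(a + b) -> 'I_N}) : R[i] :=
  \sum_(m : walled_matching a b) f m * rho (val m) i j.

Definition rho_brauer k (f : matching k -> R[i])
    (i j : {ffun 'I_k -> 'I_N}) : R[i] :=
  \sum_(m : matching k) f m * rho m i j.

Record is_weingarten_SU (mu : probability (gauge_group R SU N) R)
    (Wg : forall a b, walled_matching a b -> R[i]) : Prop := IsWeingartenSU {
  weingarten_SU_moment : forall a b (i j : {ffun 'I_(a + b) -> 'I_N}),
    cintegral mu (fun U => \prod_(r < a + b)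
      if (r < a)%N then gmx U (i r) (j r) else (gmx U (i r) (j r))^*%C)
    = rho_walled (@Wg a b) i j;
  weingarten_SU_transpose : forall a b (m m' : walled_matching a b),
    is_transpose (val m) (val m') -> Wg a b m' = Wg a b m;
  weingarten_SU_conjugate :
    forall a b (g : 'S_(a + b)) (m m' : walled_matching a b),
      (forall r, (g r < a)%N = (r < a)%N) ->
      is_conjugate g (val m) (val m') -> Wg a b m' = Wg a b m }.

Record is_weingarten_SO (mu : probability (gauge_group R SO N) R)
    (Wg : forall k, matching k -> R[i]) : Prop := IsWeingartenSO {
  weingarten_SO_moment : forall k (i j : {ffun 'I_k -> 'I_N}),
    cintegral mu (fun U => \prod_(r < k) gmx U (i r) (j r))
    = rho_brauer (@Wg k) i j;
  weingarten_SO_transpose : forall k (m m' : matching k),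
    is_transpose m m' -> Wg k m' = Wg k m;
  weingarten_SO_conjugate : forall k (g : 'S_k) (m m' : matching k),
    is_conjugate g m m' -> Wg k m' = Wg k m }.

End Weingarten.

(* [edge] is the set of positively oriented edges, one per unoriented edge. *)
Record lattice := Lattice {
  vertex : finType;
  edge : finType;
  source : edge -> vertex;
  target : edge -> vertex }.

Section Loops.
Variable L : lattice.

(* (e, true) stands for e and (e, false) for e^-1. *)
Definition letter := (edge L * bool)%type.

Definition origin (x : letter) := if x.2 then source x.1 else target x.1.
Definition endpoint (x : letter) := if x.2 then target x.1 else source x.1.

Definition closed_path (w : seq letter) : bool :=
  (w != [::]) && cycle (fun x y => endpoint x == origin y) w.

Definition based_loop := {w : seq letter | closed_path w}.

Definition cyc_eq (u v : based_loop) : bool :=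
  [exists k : 'I_(size (val u)).+1, val v == rot k (val u)].

Lemma cyc_eqP u v : reflect (exists k, val v = rot k (val u)) (cyc_eq u v).
Proof.
apply: (iffP existsP) => [[k /eqP ->]|[k ->]]; first by exists k.
have lt_k : (minn k (size (val u)) < (size (val u)).+1)%N by rewrite ltnS geq_minr.
by exists (Ordinal lt_k); rewrite /= -rot_minn.
Qed.

Lemma cyc_eq_equiv : equiv_class_of cyc_eq.
Proof.
split=> [u|u v|v u w].
- by apply/cyc_eqP; exists 0; rewrite rot0.
- by apply/cyc_eqP/cyc_eqP=> -[k E]; eexists; rewrite E -[LHS](rotK k) /rotr.
- move=> /cyc_eqP[k Ev] /cyc_eqP[l Ew].
  by apply/cyc_eqP; rewrite Ew Ev rot_rot_add; eexists.
Qed.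

Canonical cyc_eq_equivRel := EquivRelPack cyc_eq_equiv.

Definition loop := {eq_quot cyc_eq}%qT.
HB.instance Definition _ := Choice.on loop.

Definition loop_word (l : loop) : seq letter := val (repr l).

Definition word_rev (w : seq letter) : seq letter := rev (map (@flip _) w).

Lemma closed_path_rev w : closed_path w -> closed_path (word_rev w).
Proof.
case/andP=> w0 cw; apply/andP; split.
  by rewrite -size_eq0 size_rev size_map size_eq0.
rewrite rev_cycle cycle_map; apply: sub_cycle cw => -[x ox] [y oy].
by rewrite /= /origin /endpoint /= eq_sym; case: ox; case: oy.
Qed.

Definition loop_rev (l : loop) : loop :=
  (\pi_loop (Sub _ (closed_path_rev (valP (repr l))) : based_loop))%qT.

End Loops.

Section YangMills.
Variables (R : realType) (G : gauge_kind) (N : nat) (L : lattice).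
Variables (mu : probability (gauge_group R G N) R).
Variables (P : {fset loop L}) (beta : R).

Definition config := #|edge L|.-tuple (gauge_group R G N).

Definition letter_mx (Q : config) (x : letter L) : 'M[R[i]]_N :=
  let U := gmx (tnth Q (enum_rank x.1)) in if x.2 then U else invmx U.

Definition holonomy (Q : config) (w : seq (letter L)) : 'M[R[i]]_N :=
  \prod_(x <- w) letter_mx Q x.

Lemma tr_holonomy_rot Q k w : \tr (holonomy Q (rot k w)) = \tr (holonomy Q w).
Proof.
rewrite -[in RHS](cat_take_drop k w) /rot /holonomy !big_cat /=.
exact: mxtrace_mulC.
Qed.

Definition wilson n (s : n.-tuple (loop L)) (Q : config) : R[i] :=
  \prod_(l <- s) (N%:R^-1 * \tr (holonomy Q (loop_word l))).

Definition ym_weight (Q : config) : R[i] :=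
  \prod_(p : P) cexp (N%:R * beta%:C%C * \tr (holonomy Q (loop_word (val p)))).

Definition partition_function : R[i] :=
  cintegral (tuple_prob mu #|edge L|) ym_weight.

Definition wilson_expectation n (s : n.-tuple (loop L)) : R[i] :=
  cintegral (tuple_prob mu #|edge L|)
    (fun Q => partition_function^-1 * ym_weight Q * wilson s Q).

End YangMills.

Section FEPE.
Variables (L : lattice) (P : {fset loop L}) (n : nat) (s : n.-tuple (loop L)).
Variable K : {ffun P -> nat}.

Definition plaquette_copy := {p : P & 'I_(K p)}.
Definition word_idx := ('I_n + plaquette_copy)%type.

Definition Gamma_word (f : word_idx) : seq (letter L) :=
  match f with
  | inl i => loop_word (tnth s i)
  | inr c => loop_word (val (tag c))
  end.

Definition strand := {f : word_idx & 'I_(size (Gamma_word f))}.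

Definition strand_letter (x : strand) : letter L :=
  tnth (in_tuple (Gamma_word (tag x))) (tagged x).

Definition next_strand (x : strand) : strand :=
  Tagged (fun f => 'I_(size (Gamma_word f))) (ordS (tagged x)).

(* End vertices of strands, with the same encoding as in [matching]. A strand
   carrying e runs left to right and one carrying e^-1 right to left. *)
Definition strand_end := (strand * bool)%type.
Definition strand_start (x : strand) : strand_end := (x, ~~ (strand_letter x).2).
Definition strand_finish (x : strand) : strand_end := (x, (strand_letter x).2).

Definition strands_at (x : letter L) : {set strand} :=
  [set y | strand_letter y == x].

Definition npos (e : edge L) : nat := #|strands_at (e, true)|.
Definition nneg (e : edge L) : nat := #|strands_at (e, false)|.

Definition strand_of (e : edge L) (r : 'I_(npos e + nneg e)) : strand :=
  match fintype.split r with inl i => enum_val i | inr i => enum_val i end.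

Definition end_of (e : edge L) (x : 'I_(npos e + nneg e) * bool) : strand_end :=
  (strand_of x.1, x.2).

(* A labelled embedding (M, phi) is encoded by the family (pi_e) it is built from;
   phi sends a strand x to (strand_letter x).1 and a plaquette copy to its tag. *)
Definition fepe_SU := {dffun forall e : edge L, walled_matching (npos e) (nneg e)}.
Definition fepe_SO := {dffun forall e : edge L, matching (npos e + nneg e)}.

Section Map.
Variable pi : forall e : edge L, matching (npos e + nneg e).

Definition yellow_glue (x y : strand_end) : bool :=
  [exists z : strand, (x == strand_finish z) && (y == strand_start (next_strand z))].

Definition blue_glue (x y : strand_end) : bool :=
  [exists e : edge L, [exists z : 'I_(npos e + nneg e) * bool,
     (x == end_of z) && (y == end_of (partner (pi e) z))]].

Definition map_vertices : {set {set strand_end}} :=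
  equivalence_partition
    (connect (fun x y => [|| yellow_glue x y, yellow_glue y x | blue_glue x y]))
    [set: strand_end].

(* The edges are the strands and the yellow faces that remain after deletion of
   those of the string are the plaquette copies. *)
Definition euler_char : int :=
  #|map_vertices|%:Z - #|{: strand}|%:Z
  + (\sum_(e : edge L) #|cycles (pi e)| + #|{: plaquette_copy}|)%N%:Z.

End Map.

Definition area : nat := (\sum_(p : P) K p)%N.
Definition fact_fibers : nat := (\prod_(p : P) (K p)`!)%N.

Section Term.
Variables (R : realType) (N : nat) (beta : R).

Definition wg_normalised k (m : matching k) (w : R[i]) : R[i] :=
  N%:R ^ (k%:Z - #|cycles m|%:Z) * w.

Definition fepe_SU_term (Wg : forall a b, walled_matching a b -> R[i])
    (M : fepe_SU) : R[i] :=
  (beta ^+ area / fact_fibers%:R)%:C%C *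
  (\prod_(e : edge L) wg_normalised (val (M e)) (Wg _ _ (M e))) *
  N%:R ^ (euler_char (fun e => val (M e)) - n%:Z).

Definition fepe_SO_term (Wg : forall k, matching k -> R[i])
    (M : fepe_SO) : R[i] :=
  (beta ^+ area / fact_fibers%:R)%:C%C *
  (\prod_(e : edge L) wg_normalised (M e) (Wg _ (M e))) *
  N%:R ^ (euler_char M - n%:Z).

End Term.
End FEPE.

(* Main.v *)
Require Import Defs.
From HB Require Import structures.
From mathcomp Require Import all_boot all_order all_algebra.
From mathcomp Require Import finmap complex spectral ring lra.
From mathcomp Require Import all_classical all_reals all_analysis.
From mathcomp Require Import measurable_realfun.

Set Implicit Arguments.
Unset Strict Implicit.
Unset Printing Implicit Defensive.

Import Order.TTheory GRing.Theory Num.Theory.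
Import numFieldNormedType.Exports.

Local Open Scope classical_set_scope.
Local Open Scope ring_scope.

(** Expanding every factor of the Boltzmann weight,
      exp(N beta Tr Q_p) = sum_k (N beta Tr Q_p)^k / k!,
    writes the weight times the Wilson observable as an absolutely convergent
    sum, over the multiplicities K : P -> nat, of a scalar times the product
    of the traces of all the words of Gamma(s, K). Traces of unitary matrices
    are bounded by N, so on a probability space dominated convergence over the
    boxes K < 2m exchanges this sum with the integral
    ([expectation_series]).

    It remains to integrate one product of traces ([cintegral_prod_trace]).
    Writing a trace as a sum over cyclic index sequences turns the product of
    all traces into a sum over labellings h of the strands of products of
    matrix entries ([prod_trace_holonomy]): the label of a strand is the index
    at its start, and the index at its finish is the label of the next strand,
    so that yellow gluing is built in. As Q^-1 is the conjugate transpose of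
    Q, a strand carrying e^-1 contributes a conjugate entry of Q_e, read at the
    same left and right vertices as a strand carrying e. Grouping strands by
    edge, independence of the Q_e and the Weingarten formula replace the
    product by a sum over families of matchings (pi_e)_e of prod_e Wg(pi_e),
    restricted to the labellings that agree along the pairs of all pi_e. For
    fixed (pi_e)_e these are the functions on strand ends constant on the
    vertices of the map, hence there are N^V of them, V the number of vertices
    ([card_blue_compatible]).

    The power of N is then V + area - n. Since the number of strands is
    the sum over e of the sizes of the pi_e, normalising Wg by
    N^(size - cycles) and multiplying by N^(chi - n) gives the same power
    ([fepe_termE]).

    The two gauge groups differ only in the set of matchings that is summed
    over: entries of SO(N) are real, so the conjugations are invisible there.
    The argument is therefore carried out for an arbitrary family of finite
    types mapping to matchings, and specialised at the end. *)

(** * The exponential series in the complex plane *)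

Section ExpSum.
Variable F : numFieldType.

Definition exp_sum m (z : F) : F := \sum_(k < m) z ^+ k / k`!%:R.

(** The terms of the double series of exp x * exp y that lie in the triangle
    i + j < 2m but outside the square i, j < m. They are the difference between
    the partial sums of exp (x + y) and of exp x * exp y, and their moduli are
    the terms of the same tail at the moduli of x and y; so the real functional
    equation forces the complex tails to vanish in the limit. *)
Definition exp_tail m (x y : F) : F :=
  \sum_(i < m.*2) \sum_(j < m.*2 | (i + j < m.*2)%N && ~~ ((i < m)%N && (j < m)%N))
    (x ^+ i / i`!%:R) * (y ^+ j / j`!%:R).

Lemma exp_sumD m (x y : F) :
  exp_sum m (x + y) = \sum_(i < m) \sum_(j < m | (i + j < m)%N)
    (x ^+ i / i`!%:R) * (y ^+ j / j`!%:R).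
Proof.
transitivity (\sum_(n < m) \sum_(i < m | (i <= n)%N)
    (x ^+ i / i`!%:R) * (y ^+ (n - i) / (n - i)`!%:R)).
  apply: eq_bigr => n _.
  rewrite addrC exprDn mulr_suml -(big_mkord xpredT
    (fun i => y ^+ (n - i) * x ^+ i *+ 'C(n, i) / n`!%:R)) big_mkord.
  rewrite (big_ord_widen m (fun i => y ^+ (n - i) * x ^+ i *+ 'C(n, i) / n`!%:R))//.
  apply: eq_big => // i; rewrite ltnS => le_in.
  rewrite -(bin_fact le_in) -mulr_natr !natrM.
  have f0 k : (k`!%:R : F) != 0 by rewrite pnatr_eq0 -lt0n fact_gt0.
  have b0 : ('C(n, i)%:R : F) != 0 by rewrite pnatr_eq0 -lt0n bin_gt0.
  by field; rewrite !f0 b0.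
rewrite (exchange_big_dep xpredT)//=; apply: eq_bigr => i _.
set G := fun n : nat => x ^+ i / i`!%:R * (y ^+ (n - i) / (n - i)`!%:R).
have im := ltnW (ltn_ord i).
transitivity (\sum_(i <= n < m) G n).
  rewrite (big_nat_widenl _ 0%N)// big_mkord.
  by apply: eq_bigl => n; rewrite andTb.
rewrite -{1}[i : nat]add0n big_addn big_mkord.
rewrite (big_ord_widen_cond m xpredT (fun n => G (n + i)%N)) ?leq_subr//.
by apply: eq_big => [j|j _]; rewrite ?andTb ?ltn_subRL// /G addnK.
Qed.

(** The square i, j < m sits inside the triangle i + j < 2m, which is why the
    partial sum of exp (x + y) is taken at 2m. *)
Lemma exp_tailE m (x y : F) :
  exp_sum m.*2 (x + y) - exp_sum m x * exp_sum m y = exp_tail m x y.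
Proof.
have m2 : (m <= m.*2)%N by rewrite -addnn leq_addr.
rewrite exp_sumD; apply/eqP; rewrite subr_eq addrC; apply/eqP.
have -> : exp_sum m x * exp_sum m y = \sum_(i < m.*2) \sum_(j < m.*2 | (i < m)%N && (j < m)%N)
    (x ^+ i / i`!%:R) * (y ^+ j / j`!%:R).
  rewrite /exp_sum mulr_suml (big_ord_widen m.*2 (fun i => x ^+ i / i`!%:R * _))//.
  rewrite big_mkcond; apply: eq_bigr => i _.
  case: (ltnP i m) => im /=; last by rewrite big_pred0.
  by rewrite mulr_sumr (big_ord_widen m.*2
    (fun j => x ^+ i / i`!%:R * (y ^+ j / j`!%:R))).
rewrite -big_split/=; apply: eq_bigr => i _.
rewrite (bigID (fun j : 'I__ => (i < m)%N && (j < m)%N))/=; congr (_ + _).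
apply: eq_bigl => j; rewrite andbC; case: (ltnP i m) (ltnP j m) => im [] jm //=.
by have := leq_add im (ltnW jm); rewrite addSn addnn.
Qed.

End ExpSum.

Section ComplexExp.
Variable R : realType.
Local Notation normc := (@Normc.normc R).
Implicit Types (u v : nat -> R[i]) (z w : R[i]).

Lemma normcE z : `|z| = (normc z)%:C%C. Proof. by []. Qed.

Lemma normc_ge0 z : 0 <= normc z.
Proof. by case: z => a b; exact: sqrtr_ge0. Qed.

Lemma normc_natr n : normc n%:R = n%:R.
Proof. by apply: complexI; rewrite -normcE normr_nat rmorph_nat. Qed.

Lemma normc_real (x : R) : normc x%:C%C = `|x|.
Proof. by rewrite /= expr0n addr0 sqrtr_sqr. Qed.

Lemma normc_exp z n : normc (z ^+ n) = normc z ^+ n.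
Proof. by apply: complexI; rewrite -normcE normrX normcE rmorphXn. Qed.

Lemma normc_prod (I : finType) (f : I -> R[i]) :
  normc (\prod_i f i) = \prod_i normc (f i).
Proof. by apply: complexI; rewrite -normcE normr_prod rmorph_prod. Qed.

Lemma ler_normc_sum (I : Type) (r : seq I) (P : pred I) (f : I -> R[i]) :
  normc (\sum_(i <- r | P i) f i) <= \sum_(i <- r | P i) normc (f i).
Proof. by rewrite -lecR -normcE rmorph_sum; exact: ler_norm_sum. Qed.

Lemma normc_Re z : `|complex.Re z| <= normc z.
Proof. by rewrite -lecR -normcE normc_ge_Re. Qed.

Lemma normc_Im z : `|complex.Im z| <= normc z.
Proof.
case: z => a b /=; rewrite -(sqrtr_sqr b); apply: ler_wsqrtr.
by rewrite lerDr sqr_ge0.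
Qed.

(** Convergence in the plane, coordinatewise, which is the form in which
    integrals and sums of complex families are defined. *)
Definition ccvg u z := ((fun m => complex.Re (u m)) @ \oo --> complex.Re z) /\
  ((fun m => complex.Im (u m)) @ \oo --> complex.Im z).

Lemma ccvg_unique u z w : ccvg u z -> ccvg u w -> z = w.
Proof.
move=> [zr zi] [wr wi]; apply/eqP; rewrite eq_complex; apply/andP; split; apply/eqP.
  exact: cvg_unique zr wr.
exact: cvg_unique zi wi.
Qed.

Lemma ccvg_cst z : ccvg (fun _ => z) z.
Proof. by split; exact: cvg_cst. Qed.

Lemma ccvgD u v z w : ccvg u z -> ccvg v w -> ccvg (fun m => u m + v m) (z + w).
Proof.
by move=> [ur ui] [vr vi]; split; rewrite raddfD/=;
  under eq_fun do rewrite raddfD/=; exact: cvgD.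
Qed.

Lemma Re_mulc z w : complex.Re (z * w) =
  complex.Re z * complex.Re w - complex.Im z * complex.Im w.
Proof. by case: z; case: w. Qed.

Lemma Im_mulc z w : complex.Im (z * w) =
  complex.Re z * complex.Im w + complex.Im z * complex.Re w.
Proof. by case: z; case: w. Qed.

Lemma ccvgM u v z w : ccvg u z -> ccvg v w -> ccvg (fun m => u m * v m) (z * w).
Proof.
move=> [ur ui] [vr vi]; split; rewrite ?Re_mulc ?Im_mulc.
  under eq_fun do rewrite Re_mulc.
  by apply: cvgB; exact: cvgM.
under eq_fun do rewrite Im_mulc.
by apply: cvgD; exact: cvgM.
Qed.

Lemma ccvg_prod (I : finType) (u : I -> nat -> R[i]) (z : I -> R[i]) :
  (forall i, ccvg (u i) (z i)) -> ccvg (fun m => \prod_i u i m) (\prod_i z i).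
Proof.
move=> uz; elim: (index_enum I) => [|i r IH].
  by rewrite big_nil; under eq_fun do rewrite big_nil; exact: ccvg_cst.
by rewrite big_cons; under eq_fun do rewrite big_cons; exact: ccvgM.
Qed.

Lemma normc_cvg0 u : (fun m => normc (u m)) @ \oo --> 0 -> ccvg u 0.
Proof.
move=> u0; split; rewrite raddf0; apply/norm_cvg0P.
  apply: (squeeze_cvgr _ (cvg_cst 0) u0).
  by apply: nearW => m; rewrite normr_ge0 normc_Re.
apply: (squeeze_cvgr _ (cvg_cst 0) u0).
by apply: nearW => m; rewrite normr_ge0 normc_Im.
Qed.

Lemma exp_sum_cvg (x : R) : (fun m => exp_sum m x) @ \oo --> expR x.
Proof.
rewrite (_ : (fun m => _) = series (exp_coeff x)); first exact: is_cvg_series_exp_coeff.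
by apply/funext => m; rewrite /series/= big_mkord.
Qed.

Lemma exp_sum_le (x : R) m : 0 <= x -> exp_sum m x <= expR x.
Proof.
move=> x0; have -> : exp_sum m x = series (exp_coeff x) m.
  by rewrite /series/= big_mkord.
apply: nondecreasing_cvgn_le; last exact: is_cvg_series_exp_coeff.
by apply: nondecreasing_series => n _ _; apply: exp_coeff_ge0.
Qed.

Lemma normc_term z k : normc (z ^+ k / k`!%:R) = normc z ^+ k / k`!%:R.
Proof. by rewrite Normc.normcM normc_exp Normc.normcV normc_natr. Qed.

Lemma normc_exp_sum z m : normc (exp_sum m z) <= expR (normc z).
Proof.
apply: le_trans (exp_sum_le m (normc_ge0 z)).
by apply: le_trans (ler_normc_sum _ _ _) _; under eq_bigr do rewrite normc_term.
Qed.

Lemma normc_exp_tail m z w : normc (exp_tail m z w) <= exp_tail m (normc z) (normc w).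
Proof.
apply: le_trans (ler_normc_sum _ _ _) (ler_sum _ _) => i _.
apply: le_trans (ler_normc_sum _ _ _) (ler_sum _ _) => j _.
by rewrite Normc.normcM !normc_term.
Qed.

Lemma cvg_double (f : nat -> R) (l : R) : f @ \oo --> l -> (fun m => f m.*2) @ \oo --> l.
Proof.
move=> fl; apply: (cvg_comp _ _ _ fl) => A [M _ MA].
by exists M => // m /= Mm; apply: MA => /=; rewrite (leq_trans Mm)// -addnn leq_addr.
Qed.

Lemma exp_tail_cvg (x y : R) : (fun m => exp_tail m x y) @ \oo --> (0 : R).
Proof.
under eq_fun do rewrite -exp_tailE.
rewrite -(subrr (expR (x + y))) [X in _ - X]expRD.
exact: (cvgB (cvg_double (@exp_sum_cvg (x + y))) (cvgM (@exp_sum_cvg x) (@exp_sum_cvg y))).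
Qed.

Lemma exp_sum_real (x : R) m : exp_sum m x%:C%C = (exp_sum m x)%:C%C.
Proof.
rewrite /exp_sum rmorph_sum; apply: eq_bigr => k _.
by rewrite rmorphM/= rmorphXn fmorphV rmorph_nat.
Qed.

(** Written with the coefficients of the cosine and sine series. *)
Lemma exprI (y : R) k : (Complex 0 y) ^+ k =
  Complex ((~~ odd k)%:R * (-1) ^+ k./2 * y ^+ k) ((odd k)%:R * (-1) ^+ k.-1./2 * y ^+ k).
Proof.
elim: k => [|k IH]; first by rewrite !expr0 !mulr1.
rewrite exprS IH; apply/eqP; rewrite eq_complex Re_mulc Im_mulc /=.
rewrite !mul0r negbK exprS.
case: (boolP (odd k)) => ok; rewrite ?mulr0n ?mulr1n !(mul0r, mul1r, mulr0).
  have -> : uphalf k = k.-1./2.+1 by case: (k) ok => // k' /=; rewrite uphalfE.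
  by rewrite ?eqb_id; apply/andP; split; apply/eqP; rewrite ?addr0// exprS; ring.
by rewrite ?eqb_id; apply/andP; split; apply/eqP; rewrite ?oppr0//; ring.
Qed.

Lemma exp_sum_imag (y : R) : ccvg (fun m => exp_sum m (Complex 0 y)) (Complex (cos y) (sin y)).
Proof.
have E m : exp_sum m (Complex 0 y) =
    Complex (series (cos_coeff y) m) (series (sin_coeff y) m).
  rewrite /series/= !big_mkord /exp_sum.
  apply/eqP; rewrite eq_complex !raddf_sum/=; apply/andP; split; apply/eqP;
    apply: eq_bigr => k _; rewrite exprI -(rmorph_nat (real_complex R)) -fmorphV.
    by rewrite Re_mulc/= mulr0 subr0.
  by rewrite Im_mulc/= mulr0 add0r.
split => /=; under eq_fun do rewrite E/=.
  by rewrite unlock; exact: is_cvg_series_cos_coeff.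
by rewrite unlock; exact: is_cvg_series_sin_coeff.
Qed.

(** Splitting z = a + ib reduces the claim to the real exponential and to the
    series of cos and sin, up to a tail controlled by the one at the moduli. *)
Lemma exp_sum_cexp z : ccvg (fun m => exp_sum m.*2 z) (cexp z).
Proof.
case: z => a b; have -> : Complex a b = a%:C%C + Complex 0 b.
  by apply/eqP; rewrite eq_complex /= addr0 add0r !eqxx.
have -> : (fun m => exp_sum m.*2 (a%:C%C + Complex 0 b)) = (fun m =>
    exp_sum m a%:C%C * exp_sum m (Complex 0 b) + exp_tail m a%:C%C (Complex 0 b)).
  by apply/funext => m; rewrite -exp_tailE addrCA subrr addr0.
rewrite -[cexp _]addr0; apply: ccvgD.
  rewrite /cexp/= addr0 add0r; apply: ccvgM; last exact: exp_sum_imag.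
  under eq_fun do rewrite exp_sum_real.
  by split => /=; [exact: exp_sum_cvg|exact: cvg_cst].
apply: normc_cvg0; apply: (squeeze_cvgr _ (cvg_cst 0) (@exp_tail_cvg `|a| (normc (Complex 0 b)))).
apply: nearW => m; rewrite normc_ge0/= -normc_real.
exact: normc_exp_tail.
Qed.

End ComplexExp.

(** * Absolutely summable families as limits along boxes *)

(** An absolutely summable family is summed along any growing sequence of finite
    sets that eventually contains every finite set; the sets are given as ranges
    of injections of finite types, so that sums over them are finite big
    operators. *)
Section Exhaustion.
Variables (R : realType) (I : choiceType) (J : nat -> finType).
Variable g : forall m, J m -> I.
Hypothesis g_inj : forall m, injective (g (m := m)).
Hypothesis g_exh : forall X : set I, finite_set X ->
  exists M, forall m, (M <= m)%N -> X `<=` range (g (m := m)).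

Lemma fsum_range m (a : I -> R) :
  (\sum_(x \in range (g (m := m))) (a x)%:E = (\sum_j a (g (m := m) j))%:E)%E.
Proof.
rewrite fsbig_image; last by move=> x y _ _; exact: g_inj.
have -> : [set: J m] = [set` enum (J m)].
  by apply/seteqP; split=> x _ //=; rewrite mem_enum.
by rewrite -fsbig_seq ?enum_uniq//= big_enum/= sumEFin.
Qed.

Lemma esum_exhaustion (a : I -> R) (C : R) : (forall i, 0 <= a i) ->
  (forall m, \sum_j a (g (m := m) j) <= C) ->
  (\esum_(i in [set: I]) (a i)%:E < +oo)%E /\
  (fun m => \sum_j a (g (m := m) j)) @ \oo --> fine (\esum_(i in [set: I]) (a i)%:E).
Proof.
move=> a0 aC; set S := (\esum_(i in _) _)%E.
have finr m : finite_set (range (g (m := m))) by exact: finite_image.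
have X_le X m : finite_set X -> X `<=` range (g (m := m)) ->
    (\sum_(x \in X) (a x)%:E <= (\sum_j a (g (m := m) j))%:E)%E.
  move=> finX XS; rewrite -fsum_range; apply: lee_fsum_nneg_subset => //.
    exact/subsetP.
  by move=> t _; rewrite lee_fin.
have S_ge m : ((\sum_j a (g (m := m) j))%:E <= S)%E.
  by apply: esum_ge; exists (range (g (m := m))); rewrite ?fsum_range//; split.
have S_le : (S <= C%:E)%E.
  apply: ge_ereal_sup => _ [X [finX _] <-].
  have [M XM] := g_exh finX.
  by apply: le_trans (X_le _ _ finX (XM _ (leqnn M))) _; rewrite lee_fin.
have S0 : (0 <= S)%E by apply: esum_ge0 => i _; rewrite lee_fin.
have Sfin : S \is a fin_num.
  by rewrite ge0_fin_numE// (le_lt_trans S_le) ?ltry.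
split; first by rewrite (le_lt_trans S_le) ?ltry.
apply/cvgrPdist_lt => e e0.
have [_ [X [finX _] <-]] := ub_ereal_sup_adherent e0 Sfin.
rewrite -[ereal_sup _]/S -(fineK Sfin) => SX.
have [M XM] := g_exh finX.
exists M => // m /= Mm.
have := lt_le_trans SX (X_le _ _ finX (XM m Mm)).
rewrite -EFinB lte_fin => h.
have := S_ge m; rewrite -(fineK Sfin) lee_fin => h2.
by rewrite ger0_norm ?subr_ge0//; lra.
Qed.

Lemma rsum_exhaustion (f : I -> R) (C : R) :
  (forall m, \sum_j `|f (g (m := m) j)| <= C) ->
  (fun m => \sum_j f (g (m := m) j)) @ \oo --> rsum f.
Proof.
move=> fC.
have posC m : \sum_j Num.max (f (g (m := m) j)) 0 <= C.
  by apply: le_trans (fC m); apply: ler_sum => j _; rewrite ge_max ler_norm normr_ge0.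
have negC m : \sum_j Num.max (- f (g (m := m) j)) 0 <= C.
  apply: le_trans (fC m); apply: ler_sum => j _.
  by rewrite ge_max -normrN ler_norm normr_ge0.
have max0 (x : R) : 0 <= Num.max x 0 by rewrite le_max lexx orbT.
have [_ hp] := @esum_exhaustion (fun i => Num.max (f i) 0) C (fun i => max0 _) posC.
have [_ hn] := @esum_exhaustion (fun i => Num.max (- f i) 0) C (fun i => max0 _) negC.
have E m : \sum_j f (g (m := m) j) =
    \sum_j Num.max (f (g (m := m) j)) 0 - \sum_j Num.max (- f (g (m := m) j)) 0.
  rewrite -sumrB; apply: eq_bigr => j _.
  by rewrite /Num.max; case: ltP => ?; case: ltP => ?; lra.
under eq_fun do rewrite E.
have -> : rsum f = fine (\esum_(i in [set: I]) (Num.max (f i) 0)%:E)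
    - fine (\esum_(i in [set: I]) (Num.max (- f i) 0)%:E).
  by rewrite /rsum; congr (fine _ - fine _); apply: eq_esum => i _;
    rewrite ?funeposE ?funenegE/= ?EFin_max.
exact: cvgB hp hn.
Qed.

Lemma csum_exhaustion (f : I -> R[i]) (C : R) :
  (forall m, \sum_j Normc.normc (f (g (m := m) j)) <= C) ->
  cabs_summable f /\ ccvg (fun m => \sum_j f (g (m := m) j)) (csum f).
Proof.
move=> fC; split.
  by have [] := @esum_exhaustion (fun i => Normc.normc (f i)) C (fun i => normc_ge0 _) fC.
split; under eq_fun do rewrite raddf_sum.
  apply: (@rsum_exhaustion (fun i => complex.Re (f i)) C) => m.
  by apply: le_trans (fC m); apply: ler_sum => j _; exact: normc_Re.
apply: (@rsum_exhaustion (fun i => complex.Im (f i)) C) => m.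
by apply: le_trans (fC m); apply: ler_sum => j _; exact: normc_Im.
Qed.

End Exhaustion.

Section Boxes.
Variable P : finType.

Definition box_val m (k : {ffun P -> 'I_m}) : {ffun P -> nat} := [ffun p => k p : nat].

Lemma box_val_inj m : injective (@box_val m).
Proof. by move=> k l /ffunP kl; apply/ffunP => p; apply: val_inj; have := kl p; rewrite !ffunE. Qed.

Lemma box_exhaustive (X : set {ffun P -> nat}) : finite_set X ->
  exists M, forall m, (M <= m)%N -> X `<=` range (@box_val m.*2).
Proof.
move=> /finite_fsetP[A ->].
exists (\max_(K <- A) \max_p (K p)).+1 => m Mm K /= KA.
have Km p : (K p < m.*2)%N.
  apply: leq_trans (leq_trans Mm _); last by rewrite -addnn leq_addr.
  rewrite ltnS; apply: leq_trans (leq_bigmax p) _.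
  exact: (@leq_bigmax_seq _ (enum_fset A) xpredT (fun K : {ffun P -> nat} => \max_p K p)%N K KA isT).
by exists [ffun p => Ordinal (Km p)] => //; apply/ffunP => p; rewrite !ffunE.
Qed.

End Boxes.

(** * Integration of bounded measurable complex functions *)

Section BoundedMeasurable.
Variable R : realType.

(** On a probability space these functions are integrable, and unlike integrable
    functions they form an algebra stable under conjugation and composition with
    measurable maps. Every integrand below is built from matrix entries by these
    operations. *)
Definition bounded_measurable d (T : measurableType d) (f : T -> R[i]) : Prop :=
  [/\ measurable_fun setT (fun x => complex.Re (f x)),
      measurable_fun setT (fun x => complex.Im (f x)) &
      exists C, forall x, Normc.normc (f x) <= C].

Section Closure.
Context d (T : measurableType d).
Implicit Types f g : T -> R[i].

Lemma bmeas_cst (c : R[i]) : bounded_measurable (fun _ : T => c).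
Proof. by split => //; exists (Normc.normc c). Qed.

Lemma bmeasD f g : bounded_measurable f -> bounded_measurable g ->
  bounded_measurable (fun x => f x + g x).
Proof.
move=> [rf If [C fC]] [rg ig [D gD]]; split.
- by under eq_fun do rewrite raddfD/=; exact: measurable_funD.
- by under eq_fun do rewrite raddfD/=; exact: measurable_funD.
- by exists (C + D) => x; rewrite (le_trans (le_normcD _ _))// lerD.
Qed.

Lemma bmeasM f g : bounded_measurable f -> bounded_measurable g ->
  bounded_measurable (fun x => f x * g x).
Proof.
move=> [rf If [C fC]] [rg ig [D gD]]; split.
- by under eq_fun do rewrite Re_mulc/=; apply: measurable_funB; exact: measurable_funM.
- by under eq_fun do rewrite Im_mulc/=; apply: measurable_funD; exact: measurable_funM.
- by exists (C * D) => x; rewrite Normc.normcM ler_pM// normc_ge0.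
Qed.

Lemma bmeasZ (c : R[i]) f : bounded_measurable f -> bounded_measurable (fun x => c * f x).
Proof. exact/bmeasM/bmeas_cst. Qed.

Lemma bmeas_conj f : bounded_measurable f -> bounded_measurable (fun x => (f x)^*%C).
Proof.
move=> [rf If [C fC]]; split.
- by rewrite (_ : (fun x => _) = fun x => complex.Re (f x))//; apply/funext => x; case: (f x).
- rewrite (_ : (fun x => _) = fun x => - complex.Im (f x)); first exact: measurable_funN.
  by apply/funext => x; case: (f x).
- exists C => x; apply: le_trans (fC x); rewrite le_eqVlt; apply/orP; left; apply/eqP.
  by case: (f x) => a b /=; rewrite sqrrN.
Qed.

Lemma bmeas_sum (I : Type) (r : seq I) (f : I -> T -> R[i]) :
  (forall i, bounded_measurable (f i)) -> bounded_measurable (fun x => \sum_(i <- r) f i x).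
Proof.
move=> bf; elim: r => [|i r IH].
  by under eq_fun do rewrite big_nil; exact: bmeas_cst.
by under eq_fun do rewrite big_cons; exact: bmeasD.
Qed.

Lemma bmeas_prod (I : Type) (r : seq I) (f : I -> T -> R[i]) :
  (forall i, bounded_measurable (f i)) -> bounded_measurable (fun x => \prod_(i <- r) f i x).
Proof.
move=> bf; elim: r => [|i r IH].
  by under eq_fun do rewrite big_nil; exact: bmeas_cst.
by under eq_fun do rewrite big_cons; exact: bmeasM.
Qed.

Lemma bmeas_comp d' (T' : measurableType d') (f : T -> R[i]) (phi : T' -> T) :
  measurable_fun setT phi -> bounded_measurable f -> bounded_measurable (fun x => f (phi x)).
Proof.
move=> mphi [rf If [C fC]]; split; last by exists C.
- exact: (measurableT_comp rf mphi).
- exact: (measurableT_comp If mphi).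
Qed.

End Closure.

Section Integral.
Context d (T : measurableType d) (mu : probability T R).
Implicit Types f g : T -> R[i].

Lemma bounded_integrable (f : T -> R) (C : R) : measurable_fun setT f ->
  (forall x, `|f x| <= C) -> mu.-integrable setT (EFin \o f).
Proof.
move=> mf fC; apply: measurable_bounded_integrable => //.
  by rewrite (le_lt_trans (probability_le1 mu measurableT)) ?ltry.
exists C; split; first exact: num_real.
by move=> M CM x _ /=; rewrite (le_trans (fC x))// ltW.
Qed.

Lemma bmeas_integrable f : bounded_measurable f ->
  mu.-integrable setT (EFin \o (fun x => complex.Re (f x))) /\
  mu.-integrable setT (EFin \o (fun x => complex.Im (f x))).
Proof.
move=> [rf If [C fC]]; split; apply: (bounded_integrable (C := C)) => // x.
  exact: le_trans (normc_Re _) (fC x).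
exact: le_trans (normc_Im _) (fC x).
Qed.

Lemma Rintegral_probability_cst (r : R) : \int[mu]__ r = r.
Proof.
rewrite Rintegral_cst// (_ : fine _ = 1) ?mulr1//.
exact: (congr1 fine (probability_setT mu)).
Qed.

Lemma cintegral_cst (c : R[i]) : cintegral mu (fun _ => c) = c.
Proof.
by case: c => a b; rewrite /cintegral/= !Rintegral_probability_cst.
Qed.

Lemma cintegralD f g : bounded_measurable f -> bounded_measurable g ->
  cintegral mu (fun x => f x + g x) = cintegral mu f + cintegral mu g.
Proof.
move=> /bmeas_integrable[rf If] /bmeas_integrable[rg ig].
rewrite /cintegral; apply/eqP; rewrite eq_complex/=; apply/andP; split; apply/eqP.
  by rewrite -RintegralD//; apply: eq_Rintegral => x _; rewrite raddfD.
by rewrite -RintegralD//; apply: eq_Rintegral => x _; rewrite raddfD.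
Qed.

Lemma cintegralZ (c : R[i]) f : bounded_measurable f ->
  cintegral mu (fun x => c * f x) = c * cintegral mu f.
Proof.
move=> /bmeas_integrable[rf If].
have iZ (k : R) (h : T -> R) : mu.-integrable setT (EFin \o h) ->
    mu.-integrable setT (EFin \o (fun x => k * h x)).
  by move=> ih; have := integrableZl measurableT k ih; under eq_fun do rewrite -EFinM.
rewrite /cintegral; apply/eqP; rewrite eq_complex Re_mulc Im_mulc/=; apply/andP; split; apply/eqP.
  rewrite -!RintegralZl// -RintegralB//; try exact: iZ.
  by apply: eq_Rintegral => x _; rewrite Re_mulc.
rewrite -!RintegralZl// -RintegralD//; try exact: iZ.
by apply: eq_Rintegral => x _; rewrite Im_mulc.
Qed.

Lemma cintegral_sum (I : Type) (r : seq I) (f : I -> T -> R[i]) :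
  (forall i, bounded_measurable (f i)) ->
  cintegral mu (fun x => \sum_(i <- r) f i x) = \sum_(i <- r) cintegral mu (f i).
Proof.
move=> bf; elim: r => [|i r IH].
  by under eq_fun do rewrite big_nil; rewrite big_nil cintegral_cst.
under eq_fun do rewrite big_cons.
by rewrite big_cons -IH cintegralD//; exact: bmeas_sum.
Qed.

(** The factor 2 comes from bounding the real and imaginary parts separately. *)
Lemma normc_cintegral f (C : R) :
  bounded_measurable f -> (forall x, Normc.normc (f x) <= C) ->
  Normc.normc (cintegral mu f) <= C *+ 2.
Proof.
move=> bf fC; have [rf If] := bmeas_integrable bf.
have H (h : T -> R) : mu.-integrable setT (EFin \o h) -> (forall x, `|h x| <= C) ->
    `|\int[mu]_x h x| <= C.
  move=> ih hC; apply: le_trans (le_normr_Rintegral measurableT ih) _.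
  have <- : \int[mu]_x C = C by rewrite Rintegral_probability_cst.
  apply: le_Rintegral => //; first exact: integrable_norm.
  exact: finite_measure_integrable_cst.
rewrite [cintegral mu f]complexE; apply: le_trans (le_normcD _ _) _.
have i1 : Normc.normc ('i%C : R[i]) = 1 by rewrite /= expr0n expr1n add0r sqrtr1.
rewrite Normc.normcM !normc_real i1 mul1r mulr2n lerD//.
  by apply: H => // x; exact: le_trans (normc_Re _) (fC x).
by apply: H => // x; exact: le_trans (normc_Im _) (fC x).
Qed.

Lemma cintegral_cvg (f_ : nat -> T -> R[i]) f (C : R) :
  (forall m, bounded_measurable (f_ m)) -> (forall m x, Normc.normc (f_ m x) <= C) ->
  (forall x, ccvg (f_ ^~ x) (f x)) ->
  ccvg (fun m => cintegral mu (f_ m)) (cintegral mu f).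
Proof.
move=> bf fC fl.
have H (h_ : nat -> T -> R) h : (forall m, measurable_fun setT (h_ m)) ->
   (forall m x, `|h_ m x| <= C) -> (forall x, h_ ^~ x @ \oo --> h x) ->
   (fun m => \int[mu]_x h_ m x) @ \oo --> \int[mu]_x h x.
  move=> mh hC hl.
  have mh' : measurable_fun setT h.
    by apply: (measurable_fun_cvg mh) => x _; exact: hl.
  have iC : mu.-integrable setT (fun=> C%:E) by exact: finite_measure_integrable_cst.
  have [||||ih _ l] := @dominated_convergence _ _ _ mu setT measurableT
    (fun m x => (h_ m x)%:E) (fun x => (h x)%:E) (fun=> C%:E) _ _ _ iC.
  - by move=> m; exact/measurable_EFinP.
  - exact/measurable_EFinP.
  - apply: aeW => x _; apply: cvg_EFin; last exact: hl.
    by apply: nearW.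
  - by apply: aeW => x m _; rewrite lee_fin.
  apply: fine_cvg; rewrite fineK//.
  exact: integrable_fin_num.
split; apply: H.
- by move=> m; have [] := bf m.
- by move=> m x; exact: le_trans (normc_Re _) (fC m x).
- by move=> x; have [] := fl x.
- by move=> m; have [] := bf m.
- by move=> m x; exact: le_trans (normc_Im _) (fC m x).
- by move=> x; have [] := fl x.
Qed.

End Integral.
End BoundedMeasurable.

(** * Product measures *)

Section Product.
Variable R : realType.

Section Fubini.
Context d1 d2 (T1 : measurableType d1) (T2 : measurableType d2).
Variables (m1 : probability T1 R) (m2 : probability T2 R).

Lemma Rintegral_prodM (h : T1 -> R) (k : T2 -> R) (C D : R) :
  measurable_fun setT h -> measurable_fun setT k ->
  (forall x, `|h x| <= C) -> (forall y, `|k y| <= D) ->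
  \int[(m1 \x m2)%E]_z (h z.1 * k z.2) = \int[m1]_x h x * \int[m2]_y k y.
Proof.
move=> mh mk hC kD.
have ih := bounded_integrable m1 mh hC.
have ik := bounded_integrable m2 mk kD.
have ihk : (m1 \x m2)%E.-integrable setT (EFin \o (fun z => h z.1 * k z.2)).
  apply: (@bounded_integrable _ _ _ _ _ (C * D)).
    apply: measurable_funM.
      exact: (measurableT_comp mh measurable_fst).
    exact: (measurableT_comp mk measurable_snd).
  by move=> z; rewrite normrM ler_pM.
rewrite {1}/Rintegral -(integral12_prod_meas1 ihk)/=.
rewrite -RintegralZr//; congr fine; apply: eq_integral => x _.
rewrite /fubini_F/=.
under eq_integral do rewrite EFinM.
by rewrite integralZl// EFinM fineK//; exact: integrable_fin_num.
Qed.

Lemma cintegral_prodM (f : T1 -> R[i]) (g : T2 -> R[i]) :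
  bounded_measurable f -> bounded_measurable g ->
  cintegral (m1 \x m2)%E (fun z => f z.1 * g z.2) = cintegral m1 f * cintegral m2 g.
Proof.
move=> bf bg; have [rf If [C fC]] := bf; have [rg ig [D gD]] := bg.
have fr x := le_trans (normc_Re _) (fC x); have fi x := le_trans (normc_Im _) (fC x).
have gr x := le_trans (normc_Re _) (gD x); have gi x := le_trans (normc_Im _) (gD x).
have M (h : T1 -> R) (k : T2 -> R) : measurable_fun setT h -> measurable_fun setT k ->
    (forall x, `|h x| <= C) -> (forall y, `|k y| <= D) ->
    (m1 \x m2)%E.-integrable setT (EFin \o (fun z => h z.1 * k z.2)).
  move=> mh mk hC kD; apply: (@bounded_integrable _ _ _ _ _ (C * D)).
    apply: measurable_funM.
      exact: (measurableT_comp mh measurable_fst).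
    exact: (measurableT_comp mk measurable_snd).
  by move=> z; rewrite normrM ler_pM.
rewrite /cintegral; apply/eqP; rewrite eq_complex Re_mulc Im_mulc/=.
apply/andP; split; apply/eqP.
  transitivity (\int[(m1 \x m2)%E]_z (complex.Re (f z.1) * complex.Re (g z.2))
      - \int[(m1 \x m2)%E]_z (complex.Im (f z.1) * complex.Im (g z.2))).
    rewrite -RintegralB//; [|exact: M rf rg fr gr|exact: M If ig fi gi].
    by apply: eq_Rintegral => z _; rewrite Re_mulc.
  by congr (_ - _); apply: (@Rintegral_prodM _ _ C D).
transitivity (\int[(m1 \x m2)%E]_z (complex.Re (f z.1) * complex.Im (g z.2))
    + \int[(m1 \x m2)%E]_z (complex.Im (f z.1) * complex.Re (g z.2))).
  rewrite -RintegralD//; [|exact: M rf ig fr gi|exact: M If rg fi gr].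
  by apply: eq_Rintegral => z _; rewrite Im_mulc.
by congr (_ + _); apply: (@Rintegral_prodM _ _ C D).
Qed.

Lemma cintegral_distribution (X : {mfun T1 >-> T2}) (f : T2 -> R[i]) : bounded_measurable f ->
  cintegral (distribution m1 X) f = cintegral m1 (fun x => f (X x)).
Proof.
move=> bf; have mX : measurable_fun setT X by [].
have bX := bmeas_comp mX bf.
have [rX iX] := bmeas_integrable m1 bX; have [rf If _] := bf.
congr Complex; congr fine.
  rewrite /distribution integral_pushforward//.
  exact/measurable_EFinP.
rewrite /distribution integral_pushforward//.
exact/measurable_EFinP.
Qed.

End Fubini.

Lemma bmeas_tuple_prod d (T : measurableType d) n (F : 'I_n -> T -> R[i]) :
  (forall i, bounded_measurable (F i)) -> bounded_measurable (fun t : n.-tuple T => \prod_(i < n) F i (tnth t i)).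
Proof.
move=> bF; apply: bmeas_prod => i.
exact: (bmeas_comp (measurable_tnth i)).
Qed.

(** Independence of the coordinates, by Fubini along the recursive construction
    of the product measure. *)
Lemma cintegral_tuple_prod d (T : measurableType d) (mu : probability T R) n
    (F : 'I_n -> T -> R[i]) : (forall i, bounded_measurable (F i)) ->
  cintegral (tuple_prob mu n) (fun t => \prod_(i < n) F i (tnth t i)) =
  \prod_(i < n) cintegral mu (F i).
Proof.
elim: n F => [|n IH] F bF.
  under eq_fun do rewrite big_ord0.
  by rewrite big_ord0 cintegral_cst.
rewrite big_ord_recl -IH//
  -(cintegral_prodM _ _ (bF ord0) (bmeas_tuple_prod (fun i => bF (lift ord0 i)))).
rewrite [LHS]/= cintegral_distribution; last exact: bmeas_tuple_prod.
congr cintegral; apply/funext => -[x t] /=.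
by rewrite big_ord_recl; congr (_ * _); apply: eq_bigr => i _; rewrite tnthS.
Qed.

End Product.

(** * Entries of gauge group elements *)

(** The rows of a unitary matrix are unit vectors. *)
Lemma normc_unitarymx_le1 (R : realType) N (U : 'M[R[i]]_N) i j :
  U \is unitarymx -> Normc.normc (U i j) <= 1.
Proof.
move=> /unitarymxP/matrixP/(_ i i).
rewrite !mxE eqxx => /(congr1 (@complex.Re R)); rewrite raddf_sum/= => h.
have E k : complex.Re (U i k * (map_mx Num.conj U^T) k i) = Normc.normc (U i k) ^+ 2.
  rewrite !mxE Re_mulc; case: (U i k) => a b /=.
  by rewrite sqr_sqrtr ?addr_ge0 ?sqr_ge0// !expr2; ring.
rewrite (eq_bigr _ (fun k _ => E k)) in h.
rewrite -(@ler_pXn2r _ 2)// ?nnegrE ?normc_ge0// expr1n -h (bigD1 j)//= lerDl.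
by apply: sumr_ge0 => k _; rewrite sqr_ge0.
Qed.

Section GaugeEntries.
Variables (R : realType) (G : gauge_kind) (N : nat).
Implicit Types U : gauge_group R G N.

(** A real orthogonal matrix is unitary, which lets both groups be treated by the
    same estimates and the same formula for inverses. *)
Lemma gmx_unitary U : gmx U \is unitarymx.
Proof.
rewrite /gmx; have := svalP U; rewrite /in_gauge; case: G U => U; first by case/andP.
case/and3P => UR /eqP UU _; apply/unitarymxP; rewrite -[RHS]UU; congr (_ *m _).
apply/matrixP => i j; rewrite !mxE; apply/CrealP.
by move/mxOverP: UR; apply.
Qed.

Lemma conj_gmx_SO (V : gauge_group R SO N) i j : (gmx V i j)^*%C = gmx V i j.
Proof.
have /and3P[/mxOverP VR _ _] := svalP V.
exact/(CrealP (VR i j)).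
Qed.

Lemma invmx_gmx U i j : invmx (gmx U) i j = (gmx U j i)^*%C.
Proof. by rewrite invmx_unitary ?gmx_unitary// !mxE. Qed.

Lemma normc_gmx_le1 U i j : Normc.normc (gmx U i j) <= 1.
Proof. exact: normc_unitarymx_le1 (gmx_unitary U). Qed.

Lemma measurable_gauge_coord (c : 'M[R]_N * 'M[R]_N -> R) : continuous c ->
  measurable_fun setT (fun U => c (gauge_coords U)).
Proof.
move=> cc; apply: (measurability _ (RGenOpens.measurableE R)) => _ [_ [a [b ->]] <-].
rewrite setTI; apply: sub_sigma_algebra.
exists (c @^-1` `]a, b[%classic) => //.
by move: cc => /continuousP; apply; exact: interval_open.
Qed.

Lemma bmeas_gmx i j : bounded_measurable (fun U => gmx U i j).
Proof.
split; last by exists 1 => U; exact: normc_gmx_le1.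
  rewrite (_ : (fun U => _) = fun U => (fun M : 'M[R]_N * 'M[R]_N => M.1 i j) (gauge_coords U)).
    apply: (@measurable_gauge_coord (fun M => M.1 i j)) => M.
    exact: (@continuous_comp _ _ _ fst (fun M : 'M[R]_N => M i j) _ cvg_fst (@coord_continuous _ _ _ i j _)).
  by apply/funext => U; rewrite mxE.
rewrite (_ : (fun U => _) = fun U => (fun M : 'M[R]_N * 'M[R]_N => M.2 i j) (gauge_coords U)).
  apply: (@measurable_gauge_coord (fun M => M.2 i j)) => M.
  exact: (@continuous_comp _ _ _ snd (fun M : 'M[R]_N => M i j) _ cvg_snd (@coord_continuous _ _ _ i j _)).
by apply/funext => U; rewrite mxE.
Qed.

Section Holonomy.
Variable L : lattice.
Implicit Types x : letter L.

Lemma letter_mxE (Q : config R G N L) x i j : letter_mx Q x i j =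
  let U := gmx (tnth Q (enum_rank x.1)) in
  if x.2 then U i j else (U j i)^*%C.
Proof. by rewrite /letter_mx; case: x.2 => //; rewrite invmx_gmx. Qed.

Lemma letter_mx_unitary (Q : config R G N L) x : letter_mx Q x \is unitarymx.
Proof.
rewrite /letter_mx; case: x.2; first exact: gmx_unitary.
by rewrite invmx_unitary ?gmx_unitary// trmxC_unitary gmx_unitary.
Qed.

Lemma holonomy_unitary (Q : config R G N L) w : holonomy Q w \is unitarymx.
Proof.
rewrite /holonomy; elim/big_ind: _ => [|U V|x _]; last exact: letter_mx_unitary.
  by apply/unitarymxP; rewrite trmx1 map_mx1 mulmx1.
exact: mul_unitarymx.
Qed.

Lemma normc_trace_holonomy (Q : config R G N L) w :
  Normc.normc (\tr (holonomy Q w)) <= N%:R.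
Proof.
apply: le_trans (ler_normc_sum _ _ _) _.
have -> : (N%:R : R) = \sum_(i < N) 1 by rewrite sumr_const card_ord.
apply: ler_sum => i _.
exact: normc_unitarymx_le1 (holonomy_unitary Q w).
Qed.

End Holonomy.
End GaugeEntries.

(** * Finite sums, traces and invariant labellings *)

Section DependentDistributivity.
Variable F : comNzRingType.

Lemma prod_sum_dffun (I : finType) (T : I -> finType) (f : forall i, T i -> F) :
  \prod_i \sum_(t : T i) f i t = \sum_(h : {dffun forall i, T i}) \prod_i f i (h i).
Proof.
transitivity (\sum_(h : fprod T) \prod_(i in I) [ffun t => f i t] (h i)).
  rewrite big_fprod.
  transitivity (\prod_i \sum_(j in tagged_with T i) untag 0 [ffun t => f i t] j).
    apply: eq_bigr => i _.
    by rewrite -(big_tag (fun i => [ffun t => f i t])); apply: eq_bigr => t _; rewrite ffunE.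
  rewrite bigA_distr_big_dep; apply: eq_bigl => g.
  by apply/familyP/familyP.
rewrite (reindex (@fprod_of_dffun I T)); last first.
  by exists (@dffun_of_fprod I T) => h _; [exact: fprod_of_dffunK|exact: dffun_of_fprodK].
by apply: eq_bigr => h _; apply: eq_bigr => i _; rewrite ffunE fprodE.
Qed.

(** A family of functions h_i on J i is a single function on the disjoint union
    of the J i. This merges the index sequences of all words into one labelling
    of all strands. *)
Lemma prod_sum_ffun_tagged (I : finType) (J : I -> finType) (T : finType)
    (f : forall i, {ffun J i -> T} -> F) :
  \prod_i \sum_(h : {ffun J i -> T}) f i h =
  \sum_(h : {ffun {i : I & J i} -> T}) \prod_i f i [ffun r => h (Tagged J r)].
Proof.
rewrite prod_sum_dffun.
pose g (h : {ffun {i : I & J i} -> T}) : {dffun forall i, {ffun J i -> T}} :=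
  [ffun i => [ffun r => h (Tagged J r)]].
rewrite (reindex g); last first.
  exists (fun k : {dffun forall i, {ffun J i -> T}} =>
      [ffun x : {i : I & J i} => k (tag x) (tagged x)]) => k _.
    by apply/ffunP => -[i r]; rewrite !ffunE/=.
  by apply/ffunP => i; rewrite ffunE; apply/ffunP => r; rewrite !ffunE/=.
by apply: eq_bigr => h _; apply: eq_bigr => i _; rewrite ffunE.
Qed.

End DependentDistributivity.

Section TraceExpansion.
Variables (T : finType).

Definition ffun_cons n (x : T) (h : {ffun 'I_n -> T}) : {ffun 'I_n.+1 -> T} :=
  [ffun i => oapp h x (unlift ord0 i)].

Definition ffun_rcons n (h : {ffun 'I_n -> T}) (x : T) : {ffun 'I_n.+1 -> T} :=
  [ffun i => oapp h x (unlift ord_max i)].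

Lemma ffun_cons0 n x (h : {ffun 'I_n -> T}) : ffun_cons x h ord0 = x.
Proof. by rewrite ffunE unlift_none. Qed.

Lemma ffun_consS n x (h : {ffun 'I_n -> T}) i : ffun_cons x h (lift ord0 i) = h i.
Proof. by rewrite ffunE liftK. Qed.

Lemma ffun_rcons_max n x (h : {ffun 'I_n -> T}) : ffun_rcons h x ord_max = x.
Proof. by rewrite ffunE unlift_none. Qed.

Lemma ffun_rcons_lift n x (h : {ffun 'I_n -> T}) i :
  ffun_rcons h x (lift ord_max i) = h i.
Proof. by rewrite ffunE liftK. Qed.

Lemma lift_ord0_max n (i : 'I_n) :
  lift ord0 (lift ord_max i) = lift ord_max (lift ord0 i) :> 'I_n.+2.
Proof.
have ni : (n <= i)%N = false by rewrite leqNgt ltn_ord.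
by apply: val_inj; rewrite /= /bump !leq0n ni add0n add1n ltnS ni.
Qed.

Lemma lift_ord0_ord_max n : lift ord0 (@ord_max n) = ord_max.
Proof. exact: val_inj. Qed.

Lemma sum_ffun_cons (F : nmodType) n (f : {ffun 'I_n.+1 -> T} -> F) :
  \sum_h f h = \sum_x \sum_(h : {ffun 'I_n -> T}) f (ffun_cons x h).
Proof.
rewrite pair_big/= (reindex (fun p : T * {ffun 'I_n -> T} => ffun_cons p.1 p.2))//=.
exists (fun h => (h ord0, [ffun i => h (lift ord0 i)])) => [[x h] _|h _] /=.
  by rewrite ffun_cons0; congr (_, _); apply/ffunP => i; rewrite ffunE ffun_consS.
apply/ffunP => i; have [j ->|->] := unliftP ord0 i; last by rewrite ffun_cons0.
by rewrite ffun_consS ffunE.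
Qed.

Lemma sum_ffun0 (F : nmodType) (f : {ffun 'I_0 -> T} -> F) (h : {ffun 'I_0 -> T}) :
  \sum_h f h = f h.
Proof. by rewrite (big_pred1 h)// => k; apply/esym/eqP/ffunP => -[]. Qed.

End TraceExpansion.

Section MatrixProduct.
Variables (F : comNzRingType) (N : nat).

(** The entry (i, j) of a product of n + 1 matrices is a sum over the n
    intermediate indices h; the r-th factor is read between position r of the
    sequence i, h and position r of the sequence h, j. *)
Lemma mxprod_path n (A : 'I_n.+1 -> 'M[F]_N) i j :
  (\prod_r A r) i j = \sum_(h : {ffun 'I_n -> 'I_N})
    \prod_r A r (ffun_cons i h r) (ffun_rcons h j r).
Proof.
elim: n A i => [|n IH] A i.
  rewrite big_ord1 (sum_ffun0 _ (ffun0 (card_ord 0))) big_ord1.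
  by rewrite ffun_cons0 (_ : ord0 = ord_max) ?ffun_rcons_max//; exact: val_inj.
rewrite big_ord_recl mxE sum_ffun_cons; apply: eq_bigr => k _.
rewrite IH mulr_sumr; apply: eq_bigr => h _; rewrite [RHS]big_ord_recl.
rewrite ffun_cons0 (_ : ffun_rcons _ _ _ = k).
  congr (_ * _); apply: eq_bigr => r _; rewrite ffun_consS; congr (A _ _ _).
  have [s ->|->] := unliftP ord_max r; last by rewrite lift_ord0_ord_max !ffun_rcons_max.
  by rewrite lift_ord0_max !ffun_rcons_lift ffun_consS.
by rewrite (_ : ord0 = lift ord_max ord0) ?ffun_rcons_lift ?ffun_cons0//; exact: val_inj.
Qed.

(** Closing the paths. Positivity of n matters: the empty product has trace N,
    whereas there is only one empty labelling. *)
Lemma mxtrace_cycle n (A : 'I_n -> 'M[F]_N) : (0 < n)%N ->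
  \tr (\prod_r A r) = \sum_(h : {ffun 'I_n -> 'I_N}) \prod_r A r (h r) (h (ordS r)).
Proof.
case: n A => // n A _; rewrite /mxtrace sum_ffun_cons; apply: eq_bigr => i _.
rewrite mxprod_path; apply: eq_bigr => h _; apply: eq_bigr => r _; congr (A r _ _).
have [s ->|->] := unliftP ord_max r.
  rewrite ffun_rcons_lift (_ : ordS _ = lift ord0 s) ?ffun_consS//.
  by apply: val_inj; rewrite /= /bump leqNgt ltn_ord add0n modn_small// ltnS ltn_ord.
rewrite ffun_rcons_max (_ : ordS _ = ord0) ?ffun_cons0//.
by apply: val_inj; rewrite /= modnn.
Qed.

End MatrixProduct.

(** A labelling that is invariant under a symmetric relation is the same thing as a
    labelling of its connected components. *)
Section InvariantLabels.
Variables (T : finType) (e : rel T) (e_sym : symmetric e) (N : nat) (N_gt0 : (0 < N)%N).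

Lemma card_invariant_ffun :
  #|[set f : {ffun T -> 'I_N} | [forall x, forall y, e x y ==> (f x == f y)]]%SET|
  = (N ^ #|equivalence_partition (connect e) [set: T]|)%N.
Proof.
set P := equivalence_partition _ _.
have csym : connect_sym e by exact: sym_connect_sym.
have eqv : {in [set: T]%SET & &, equivalence_rel (connect e)}.
  move=> x y z _ _ _; split; first exact: connect0.
  by move=> xy; exact: (same_connect csym xy).
have partP := equivalence_partitionP eqv.
have Pblk x y : (y \in finset.pblock P x) = connect e x y.
  by rewrite finset.pblock_equivalence_partition ?inE.
have /and3P[/eqP covP trivP P0] := partP.
have blkP x : finset.pblock P x \in P by rewrite finset.pblock_mem// covP inE.
pose y0 : 'I_N := Ordinal N_gt0.
(* Labellings of the blocks are represented by functions on all sets that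
   take the default value y0 outside the partition. *)
pose Phi (f : {ffun {set T} -> 'I_N}) : {ffun T -> 'I_N} := [ffun x => f (finset.pblock P x)].
rewrite -[X in (X ^ _)%N]card_ord -(card_pffun_on y0) -(card_in_imset (f := Phi)).
  congr #|pred_of_set _|; apply/setP => f; rewrite inE.
  apply/idP/imsetP => [/forallP inv|[g _ ->]].
    have finv x y : connect e x y -> f x = f y.
      case/connectP => p + ->; elim: p x => //= z p IH x /andP[xz /IH <-].
      by move/forallP: (inv x) => /(_ z); rewrite xz => /eqP.
    exists [ffun B => if B \in P then if [pick x in B] is Some x then f x else y0 else y0].
      apply/pffun_onP; split; last by move=> ? _.
      by apply/fintype.subsetP => B; rewrite inE ffunE; case: ifP; rewrite ?eqxx.
    apply/ffunP => x; rewrite !ffunE blkP; case: pickP => [y|/(_ x)].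
      by rewrite Pblk => /finv.
    by rewrite Pblk connect0.
  apply/forallP => x; apply/forallP => y; apply/implyP => xy; rewrite !ffunE.
  by rewrite -(finset.same_pblock trivP (x := y) (y := x)) ?Pblk ?connect1.
move=> f g /pffun_onP[/fintype.subsetP sf _] /pffun_onP[/fintype.subsetP sg _] /ffunP fg.
apply/ffunP => B; have [BP|nBP] := boolP (B \in P); last first.
  have -> : f B = y0 by apply/eqP; apply: contraNT nBP => /sf.
  by apply/esym/eqP; apply: contraNT nBP => /sg.
have [x xB] : exists x, x \in B by apply/set0Pn; apply: contraNneq P0 => <-.
by have := fg x; rewrite !ffunE (finset.def_pblock trivP BP xB).
Qed.

End InvariantLabels.

(** * Strands and their labellings *)

Section Strands.
Variables (L : lattice) (P : {fset loop L}) (n : nat) (s : n.-tuple (loop L)).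
Variable K : {ffun P -> nat}.
Local Notation strand := (strand s K).
Local Notation npos := (npos s K).
Local Notation nneg := (nneg s K).

Lemma strand_letter_of (e : edge L) (r : 'I_(npos e + nneg e)) :
  strand_letter (strand_of r) = (e, (r < npos e)%N).
Proof.
by rewrite /strand_of; case: fintype.splitP => i _; have := enum_valP i;
  rewrite inE => /eqP.
Qed.

(** Every strand sits at exactly one lattice edge, and there it is either one of
    the npos strands carrying the edge or one of the nneg strands carrying its
    inverse. *)
Lemma prod_strands (F : comNzRingType) (H : strand -> F) :
  \prod_x H x = \prod_e \prod_(r < npos e + nneg e) H (strand_of r).
Proof.
rewrite (partition_big (fun x => (strand_letter x).1) xpredT)//=.
apply: eq_bigr => e _.
rewrite (bigID (fun x : strand => (strand_letter x).2))/= big_split_ord/=.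
congr (_ * _).
  transitivity (\prod_(x in strands_at s K (e, true)) H x).
    apply: eq_bigl => x; rewrite inE.
    by case: strand_letter => a b; rewrite -pair_eqE /pair_eq/= eqb_id.
  rewrite big_enum_val; apply: eq_bigr => i _; congr H.
  by rewrite /strand_of (unsplitK (inl i)).
transitivity (\prod_(x in strands_at s K (e, false)) H x).
  apply: eq_bigl => x; rewrite inE.
  by case: strand_letter => a b; rewrite -pair_eqE /pair_eq/= eqbF_neg.
rewrite big_enum_val; apply: eq_bigr => i _; congr H.
by rewrite /strand_of (unsplitK (inr i)).
Qed.

Section Labels.
Variables (N : nat) (N_gt0 : (0 < N)%N).
Variable pi : forall e : edge L, matching (npos e + nneg e).

(** The matrix index at a strand end, for the labelling of strands by the index at
    their start: the index at the finish of a strand is the one at the start of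
    the next strand of the same word. *)
Definition end_label (h : {ffun strand -> 'I_N}) (x : strand_end s K) : 'I_N :=
  if x.2 == (strand_letter x.1).2 then h (next_strand x.1) else h x.1.

Lemma end_label_start h x : end_label h (strand_start x) = h x.
Proof. by rewrite /end_label/=; case: (strand_letter x).2. Qed.

Lemma end_label_finish h x : end_label h (strand_finish x) = h (next_strand x).
Proof. by rewrite /end_label/= eqxx. Qed.

Definition blue_compatible (l : strand_end s K -> 'I_N) : bool :=
  [forall e, [forall z, l (end_of z) == l (end_of (partner (pi e) z))]].

Lemma blue_glue_sym x y : blue_glue pi x y = blue_glue pi y x.
Proof.
suff H x' y' : blue_glue pi x' y' -> blue_glue pi y' x' by apply/idP/idP; exact: H.
case/existsP => e /existsP[z /andP[/eqP -> /eqP ->]].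
apply/existsP; exists e; apply/existsP; exists (partner (pi e) z).
have /forallP/(_ z)/andP[_ /eqP zz] := valP (pi e).
by rewrite eqxx/= /partner zz.
Qed.

(** Labelling strands is labelling strand ends consistently with the yellow
    gluing; the blue condition adds the other identifications, and together they
    generate the vertices of the map. *)
Lemma card_blue_compatible :
  #|[set h : {ffun strand -> 'I_N} | blue_compatible (end_label h)]%SET|
  = (N ^ #|map_vertices pi|)%N.
Proof.
rewrite -card_invariant_ffun//; last first.
  by move=> x y; rewrite /= blue_glue_sym orbCA.
pose lab (h : {ffun strand -> 'I_N}) := [ffun x => end_label h x].
rewrite -(card_in_imset (f := lab)); last first.
  move=> h k _ _ /ffunP hk; apply/ffunP => x.
  by have := hk (strand_start x); rewrite !ffunE !end_label_start.
congr #|pred_of_set _|; apply/setP => f; rewrite inE; apply/imsetP/idP.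
  case=> h; rewrite inE => /forallP bh ->.
  have Y x y : yellow_glue x y -> end_label h x = end_label h y.
    by case/existsP => z /andP[/eqP -> /eqP ->]; rewrite end_label_start end_label_finish.
  apply/forallP => x; apply/forallP => y; apply/implyP; rewrite !ffunE.
  case/or3P => [/Y ->|/Y ->|] //.
  by case/existsP => e /existsP[z /andP[/eqP -> /eqP ->]]; exact: (forallP (bh e)).
move=> /forallP inv.
have finv x y : [|| yellow_glue x y, yellow_glue y x | blue_glue pi x y] -> f x = f y.
  by move=> xy; move/forallP: (inv x) => /(_ y); rewrite xy => /eqP.
(* A labelling of ends that respects the yellow gluing is recovered from its
   values at the starts of the strands. *)
have flab x : f x = end_label [ffun y => f (strand_start y)] x.
  rewrite /end_label !ffunE; case: eqP => [E|/eqP nE].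
    apply: finv; apply/or3P; apply: Or31; apply/existsP; exists x.1.
    by rewrite eqxx andbT /strand_finish -E -surjective_pairing.
  suff {1}-> : x = strand_start x.1 by [].
  case: x nE => x b /= nE; rewrite /strand_start; congr (_, _).
  by case: b (strand_letter x).2 nE => [] [].
exists [ffun y => f (strand_start y)]; last by apply/ffunP => x; rewrite ffunE.
rewrite inE; apply/forallP => e; apply/forallP => z; rewrite -!flab; apply/eqP.
apply: finv; apply/or3P; apply: Or33; apply/existsP; exists e.
by apply/existsP; exists z; rewrite !eqxx.
Qed.

(** A product of 0/1 coefficients of rho is the indicator that all pairs carry
    equal indices, so the sum counts compatible labellings. *)
Lemma sum_prod_rho (R : realType) :
  \sum_(h : {ffun strand -> 'I_N}) \prod_e
    rho R (pi e) [ffun r => end_label h (strand_of r, false)]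
                 [ffun r => end_label h (strand_of r, true)]
  = N%:R ^+ #|map_vertices pi|.
Proof.
rewrite -natrX -card_blue_compatible -sum1_card natr_sum [RHS]big_mkcond/=.
apply: eq_bigr => h _; rewrite inE.
have E e : rho R (pi e) [ffun r => end_label h (strand_of r, false)]
    [ffun r => end_label h (strand_of r, true)]
    = [forall z, end_label h (end_of z) == end_label h (end_of (partner (pi e) z))]%:R.
  rewrite /rho; congr (nat_of_bool _)%:R; apply: eq_forallb => -[r b] /=.
  by case: (partner (pi e) (r, b)) => q c; case: b; case: c; rewrite !ffunE.
under eq_bigr do rewrite E.
case: ifPn => [/forallP bh|]; first by rewrite big1// => e _; rewrite bh.
by rewrite negb_forall => /existsP[e /negbTE be]; rewrite (bigD1 e)//= be mul0r.
Qed.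

End Labels.

Lemma size_Gamma_word_gt0 (f : word_idx n K) : (0 < size (Gamma_word s f))%N.
Proof.
have H (l : loop L) : (0 < size (loop_word l))%N.
  by have /andP[] := valP (repr l); rewrite lt0n size_eq0.
by case: f => [i|c] /=.
Qed.

End Strands.

(** * Expectation of a product of traces *)

Section TraceMoments.
Variables (R : realType) (G : gauge_kind) (N : nat) (N_gt0 : (0 < N)%N).
Variables (L : lattice) (P : {fset loop L}) (n : nat) (s : n.-tuple (loop L)).
Variable mu : probability (gauge_group R G N) R.

(** The integrand of the Weingarten formula: the entries of the first a tensor
    factors U and of the last b tensor factors conj U. *)
Definition edge_entry a b (i j : 'I_(a + b) -> 'I_N) (U : gauge_group R G N) : R[i] :=
  \prod_(r < a + b) if (r < a)%N then gmx U (i r) (j r) else (gmx U (i r) (j r))^*%C.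

Lemma bmeas_edge_entry a b (i j : 'I_(a + b) -> 'I_N) : bounded_measurable (edge_entry i j).
Proof.
apply: bmeas_prod => r; case: (r < a)%N; first exact: bmeas_gmx.
exact/bmeas_conj/bmeas_gmx.
Qed.

Lemma cintegral_prod_edges (F : edge L -> gauge_group R G N -> R[i]) :
  (forall e, bounded_measurable (F e)) ->
  cintegral (tuple_prob mu #|edge L|) (fun Q => \prod_e F e (tnth Q (enum_rank e)))
  = \prod_e cintegral mu (F e).
Proof.
move=> bF.
have E (M : edge L -> R[i]) : \prod_e M e = \prod_(k < #|edge L|) M (enum_val k).
  by rewrite -(big_enum_val (A := edge L)).
rewrite E -cintegral_tuple_prod//; congr cintegral; apply/funext => Q.
by rewrite E; apply: eq_bigr => k _; rewrite enum_valK.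
Qed.

Lemma bmeas_edge_prod (F : edge L -> gauge_group R G N -> R[i]) :
  (forall e, bounded_measurable (F e)) ->
  bounded_measurable (fun Q : config R G N L => \prod_e F e (tnth Q (enum_rank e))).
Proof.
by move=> bF; apply: bmeas_prod => e; exact: (bmeas_comp (measurable_tnth (enum_rank e))).
Qed.

Section FixedMultiplicity.
Variable K : {ffun P -> nat}.
Local Notation strand := (strand s K).
Local Notation npos := (npos s K).
Local Notation nneg := (nneg s K).

Definition edge_left (h : {ffun strand -> 'I_N}) (e : edge L) (r : 'I_(npos e + nneg e)) :=
  end_label h (strand_of r, false).
Definition edge_right (h : {ffun strand -> 'I_N}) (e : edge L) (r : 'I_(npos e + nneg e)) :=
  end_label h (strand_of r, true).

(** A strand carrying e^-1 contributes the entry (start, finish) of U^-1, which is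
    the conjugate of the entry (finish, start) of U. Its left vertex is its
    finish and its right vertex its start, so in both orientations the entry is
    read from the left label to the right label. *)
Lemma prod_trace_holonomy (Q : config R G N L) :
  \prod_(f : word_idx n K) \tr (holonomy Q (Gamma_word s f)) =
  \sum_(h : {ffun strand -> 'I_N})
    \prod_e edge_entry (@edge_left h e) (@edge_right h e) (tnth Q (enum_rank e)).
Proof.
transitivity (\sum_(h : {ffun strand -> 'I_N})
    \prod_(x : strand) letter_mx Q (strand_letter x) (h x) (h (next_strand x))).
  transitivity (\prod_(f : word_idx n K) \sum_(h : {ffun 'I_(size (Gamma_word s f)) -> 'I_N})
      \prod_r letter_mx Q (tnth (in_tuple (Gamma_word s f)) r) (h r) (h (ordS r))).
    apply: eq_bigr => f _; rewrite -mxtrace_cycle ?size_Gamma_word_gt0//.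
    by rewrite /holonomy big_tnth.
  rewrite prod_sum_ffun_tagged; apply: eq_bigr => h _.
  under eq_bigr do under eq_bigr do rewrite !ffunE.
  by rewrite sig_big_dep/=; apply: eq_bigr => -[f r] _.
apply: eq_bigr => h _; rewrite prod_strands; apply: eq_bigr => e _.
apply: eq_bigr => r _; rewrite letter_mxE strand_letter_of/= /edge_left /edge_right.
by rewrite /end_label/= strand_letter_of/=; case: (r < npos e)%N.
Qed.

Lemma bmeas_prod_trace :
  bounded_measurable (fun Q : config R G N L => \prod_(f : word_idx n K) \tr (holonomy Q (Gamma_word s f))).
Proof.
under eq_fun do rewrite prod_trace_holonomy.
apply: bmeas_sum => h; apply: (bmeas_edge_prod (F := fun e => edge_entry _ _)) => e.
exact: bmeas_edge_entry.
Qed.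

(* T a b stands for the matchings over which the Weingarten formula sums: the
   walled ones for SU, all of them for SO. *)
Variables (T : nat -> nat -> finType) (pr : forall a b, T a b -> matching (a + b)).
Variable W : forall a b, T a b -> R[i].
Hypothesis moment : forall a b (i j : {ffun 'I_(a + b) -> 'I_N}),
  cintegral mu (edge_entry i j) = \sum_(m : T a b) W m * rho R (pr m) i j.

(** After applying the Weingarten formula at every edge, exchanging the sums over
    labellings and matchings leaves a count of labellings. *)
Lemma cintegral_prod_trace :
  cintegral (tuple_prob mu #|edge L|)
    (fun Q => \prod_(f : word_idx n K) \tr (holonomy Q (Gamma_word s f)))
  = \sum_(M : {dffun forall e, T (npos e) (nneg e)})
      (\prod_e W (M e)) * N%:R ^+ #|map_vertices (fun e => pr (M e))|.
Proof.
under eq_fun do rewrite prod_trace_holonomy.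
rewrite cintegral_sum; last first.
  move=> h; apply: (bmeas_edge_prod (F := fun e => edge_entry _ _)) => e.
  exact: bmeas_edge_entry.
transitivity (\sum_(h : {ffun strand -> 'I_N}) \sum_(M : {dffun forall e, T (npos e) (nneg e)})
    \prod_e (W (M e) * rho R (pr (M e)) [ffun r => edge_left h r] [ffun r => edge_right h r])).
  apply: eq_bigr => h _.
  rewrite (cintegral_prod_edges (F := fun e => edge_entry _ _)); last first.
    by move=> e; exact: bmeas_edge_entry.
  rewrite -(prod_sum_dffun (fun e m => W m * rho R (pr m) [ffun r => edge_left h r] [ffun r => edge_right h r])).
  apply: eq_bigr => e _; rewrite -moment; congr cintegral; apply/funext => U.
  by apply: eq_bigr => r _; rewrite !ffunE.
rewrite exchange_big; apply: eq_bigr => M _.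
under eq_bigr do rewrite big_split/=.
by rewrite -mulr_sumr sum_prod_rho.
Qed.

End FixedMultiplicity.
End TraceMoments.

(** * Expansion of the weight *)

Lemma cancel_powers (F : fieldType) (x y z b f w v a : F) :
  x != 0 -> y != 0 -> z != 0 ->
  b / f * (y / z * w) * (v / y * (z * a) / x) = x^-1 * (a * b / f) * (w * v).
Proof. by move: f^-1 => u x0 y0 z0; field; rewrite x0 y0 z0. Qed.

Section Expansion.
Variables (R : realType) (G : gauge_kind) (N : nat) (N_gt0 : (0 < N)%N).
Variables (L : lattice) (P : {fset loop L}) (n : nat) (s : n.-tuple (loop L)).
Variables (mu : probability (gauge_group R G N) R) (beta : R).

Definition plaquette_action (Q : config R G N L) (p : P) : R[i] :=
  N%:R * beta%:C%C * \tr (holonomy Q (loop_word (val p))).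

Definition plaquette_bound : R := N%:R * `|beta| * N%:R.

Lemma normc_plaquette_action Q p : Normc.normc (plaquette_action Q p) <= plaquette_bound.
Proof.
rewrite !Normc.normcM normc_natr normc_real /plaquette_bound.
by apply: ler_wpM2l (normc_trace_holonomy _ _); rewrite mulr_ge0.
Qed.

Lemma normc_wilson (Q : config R G N L) : Normc.normc (wilson s Q) <= 1.
Proof.
have N0 : 0 < N%:R :> R by rewrite ltr0n.
rewrite /wilson big_tuple normc_prod; apply: prodr_ile1 => i _.
rewrite normc_ge0 Normc.normcM Normc.normcV normc_natr mulrC ler_pdivrMr// mul1r.
exact: normc_trace_holonomy.
Qed.

Definition weight_term (K : {ffun P -> nat}) (Q : config R G N L) : R[i] :=
  (\prod_p (plaquette_action Q p ^+ K p / (K p)`!%:R)) * wilson s Q.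

Definition weight_bound (K : {ffun P -> nat}) : R :=
  \prod_p (plaquette_bound ^+ K p / (K p)`!%:R).

Lemma normc_weight_term K Q : Normc.normc (weight_term K Q) <= weight_bound K.
Proof.
rewrite Normc.normcM -[leRHS]mulr1 ler_pM ?normc_ge0 ?normc_wilson//.
rewrite normc_prod; apply: ler_prod => p _; rewrite normc_ge0/= normc_term.
rewrite ler_wpM2r ?invr_ge0// lerXn2r ?nnegrE ?normc_ge0 ?normc_plaquette_action//.
exact: le_trans (normc_ge0 _) (normc_plaquette_action Q p).
Qed.

Definition word_coef (K : {ffun P -> nat}) : R[i] :=
  N%:R ^- n * \prod_p ((N%:R * beta%:C%C) ^+ K p / (K p)`!%:R).

(** The copies of the plaquettes prescribed by K together with the loops of the
    string are the words of Gamma(s, K). *)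
Lemma weight_termE K : weight_term K =
  fun Q => word_coef K * \prod_(f : word_idx n K) \tr (holonomy Q (Gamma_word s f)).
Proof.
apply/funext => Q.
have -> : \prod_(f : word_idx n K) \tr (holonomy Q (Gamma_word s f)) =
    (\prod_(i < n) \tr (holonomy Q (loop_word (tnth s i)))) *
    \prod_p \tr (holonomy Q (loop_word (val p))) ^+ K p.
  rewrite big_sumType/=; congr (_ * _).
  transitivity (\prod_p \prod_(i < K p) \tr (holonomy Q (loop_word (val p)))).
    by rewrite sig_big_dep/=; apply: eq_bigr => -[p i] _.
  by apply: eq_bigr => p _; rewrite prodr_const card_ord.
rewrite /weight_term /word_coef.
have -> : wilson s Q = N%:R ^- n * \prod_(i < n) \tr (holonomy Q (loop_word (tnth s i))).
  by rewrite /wilson big_tuple big_split/= prodr_const card_ord exprVn.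
rewrite (eq_bigr (fun p => (N%:R * beta%:C%C) ^+ K p / (K p)`!%:R *
  \tr (holonomy Q (loop_word (val p))) ^+ K p)); last first.
  by move=> p _; rewrite /plaquette_action exprMn mulrAC.
by rewrite big_split/=; ring.
Qed.

Lemma bmeas_weight_term K : bounded_measurable (weight_term K).
Proof.
rewrite weight_termE.
exact/bmeasZ/bmeas_prod_trace.
Qed.

Definition partial_weight m (Q : config R G N L) : R[i] :=
  \sum_(k : {ffun P -> 'I_m.*2}) weight_term (box_val k) Q.

(** Summing over the box K < 2m factorises over plaquettes into partial
    exponential sums; the even cutoff is the one at which those are known to
    converge. *)
Lemma partial_weightE m Q :
  partial_weight m Q = (\prod_p exp_sum m.*2 (plaquette_action Q p)) * wilson s Q.
Proof.
rewrite /exp_sum bigA_distr_bigA/= mulr_suml; apply: eq_bigr => k _.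
by rewrite /weight_term; congr (_ * _); apply: eq_bigr => p _; rewrite ffunE.
Qed.

Lemma sum_weight_bound m :
  \sum_(k : {ffun P -> 'I_m.*2}) weight_bound (box_val k) <= \prod_(p : P) expR plaquette_bound.
Proof.
have B0 : 0 <= plaquette_bound by rewrite !mulr_ge0.
rewrite (eq_bigr (fun k : {ffun P -> 'I_m.*2} =>
    \prod_p (plaquette_bound ^+ k p / (k p)`!%:R))); last first.
  by move=> k _; apply: eq_bigr => p _; rewrite ffunE.
rewrite -(bigA_distr_bigA (fun (p : P) (k : 'I_m.*2) => plaquette_bound ^+ k / k`!%:R)).
apply: ler_prod => p _; rewrite exp_sum_le// andbT.
by apply: sumr_ge0 => k _; rewrite divr_ge0// exprn_ge0.
Qed.

Lemma partial_weight_cvg Q :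
  ccvg (partial_weight ^~ Q) (ym_weight P beta Q * wilson s Q).
Proof.
under eq_fun do rewrite partial_weightE.
apply: ccvgM; last exact: ccvg_cst.
by apply: ccvg_prod => p; exact: exp_sum_cexp.
Qed.

Lemma expectation_partial_cvg :
  ccvg (fun m => (partition_function mu P beta)^-1 *
          \sum_(k : {ffun P -> 'I_m.*2})
             cintegral (tuple_prob mu #|edge L|) (weight_term (box_val k)))
    (wilson_expectation mu P beta s).
Proof.
set Z := (partition_function _ _ _)^-1.
have bS m : bounded_measurable (partial_weight m) by apply: bmeas_sum => k; exact: bmeas_weight_term.
have -> : (fun m => Z * \sum_(k : {ffun P -> 'I_m.*2})
      cintegral (tuple_prob mu #|edge L|) (weight_term (box_val k))) =
    (fun m => cintegral (tuple_prob mu #|edge L|) (fun Q => Z * partial_weight m Q)).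
  apply/funext => m; rewrite cintegralZ// cintegral_sum// => k.
  exact: bmeas_weight_term.
apply: (@cintegral_cvg _ _ _ _ _ _ (Normc.normc Z * \prod_(p : P) expR plaquette_bound)).
- by move=> m; exact: bmeasZ.
- move=> m Q; rewrite Normc.normcM ler_wpM2l ?normc_ge0//.
  apply: le_trans (ler_normc_sum _ _ _) _.
  apply: le_trans (sum_weight_bound m); apply: ler_sum => k _.
  exact: normc_weight_term.
- move=> Q; rewrite -mulrA.
  by apply: ccvgM; [exact: ccvg_cst|exact: partial_weight_cvg].
Qed.

(** Dominated convergence along the boxes identifies the expectation with the
    limit of box sums of the integrals, and the bound that dominates also gives
    the absolute summability needed to call this limit a sum over K. *)
Lemma expectation_series :
  let t K := cintegral (tuple_prob mu #|edge L|) (weight_term K) in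
  wilson_expectation mu P beta s = (partition_function mu P beta)^-1 * csum t
  /\ cabs_summable t.
Proof.
move=> t.
have [|abs_t cvg_t] := @csum_exhaustion _ _ _ (fun m => @box_val P m.*2)
  (fun m => @box_val_inj P m.*2) (@box_exhaustive P) t
  ((\prod_(p : P) expR plaquette_bound) *+ 2).
  move=> m; apply: le_trans (_ : \sum_(k : {ffun P -> 'I_m.*2}) weight_bound (box_val k) *+ 2 <= _).
    apply: ler_sum => k _; apply: normc_cintegral; first exact: bmeas_weight_term.
    by move=> Q; exact: normc_weight_term.
  by rewrite sumrMnl lerMn2r sum_weight_bound orbT.
split=> //; apply: ccvg_unique expectation_partial_cvg _.
by apply: ccvgM => //; exact: ccvg_cst.
Qed.

Section Terms.
Variables (T : nat -> nat -> finType) (pr : forall a b, T a b -> matching (a + b)).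
Variable W : forall a b, T a b -> R[i].
Hypothesis moment : forall a b (i j : {ffun 'I_(a + b) -> 'I_N}),
  cintegral mu (edge_entry i j) = \sum_(m : T a b) W m * rho R (pr m) i j.

Definition fepe_term (K : {ffun P -> nat})
    (M : {dffun forall e : edge L, T (npos s K e) (nneg s K e)}) : R[i] :=
  (beta ^+ area K / (fact_fibers K)%:R)%:C%C *
  (\prod_(e : edge L) wg_normalised N (pr (M e)) (W (M e))) *
  N%:R ^ (euler_char (fun e => pr (M e)) - n%:Z).

Lemma card_plaquette_copy (K : {ffun P -> nat}) : #|{: plaquette_copy K}| = area K.
Proof.
rewrite /area -sum1_card.
transitivity (\sum_(p : P) \sum_(i < K p) 1)%N.
  by rewrite sig_big_dep.
by apply: eq_bigr => p _; rewrite sum1_card card_ord.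
Qed.

(** Counting powers of N: the plaquettes give N^area and the string N^-n; the
    strand count and the blue faces in the Euler characteristic cancel the
    normalisation of the Weingarten elements, because the strands are distributed
    over the lattice edges. *)
Lemma fepe_termE K (M : {dffun forall e : edge L, T (npos s K e) (nneg s K e)}) :
  fepe_term M = word_coef K *
    ((\prod_e W (M e)) * N%:R ^+ #|map_vertices (fun e => pr (M e))|).
Proof.
have N0 : (N%:R : R[i]) != 0 by rewrite pnatr_eq0 -lt0n.
have -> : word_coef K = N%:R ^- n * (N%:R ^+ area K * beta%:C%C ^+ area K / (fact_fibers K)%:R).
  by rewrite /word_coef big_split/= prodfV /fact_fibers natr_prod -exprMn /area prodrXr.
rewrite /fepe_term.
have -> : \prod_e wg_normalised N (pr (M e)) (W (M e)) =
    N%:R ^+ #|{: strand s K}| / N%:R ^+ (\sum_e #|cycles (pr (M e))|) * \prod_e W (M e).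
  rewrite big_split/=; congr (_ * _).
  rewrite (eq_bigr (fun e => N%:R ^+ (npos s K e + nneg s K e) / N%:R ^+ #|cycles (pr (M e))|));
    last by move=> e _; rewrite expfzDr// exprnN.
  have -> : N%:R ^+ #|{: strand s K}| = \prod_(x : strand s K) N%:R :> R[i].
    by rewrite prodr_const.
  rewrite prodf_div !prodrXr prod_strands -prodrXr; congr (_ / _).
  by apply: eq_bigr => e _; rewrite prodr_const card_ord.
rewrite /euler_char card_plaquette_copy PoszD !expfzDr// -!exprnN -!exprnP.
rewrite rmorphM/= rmorphXn fmorphV rmorph_nat.
have S0 : (N%:R : R[i]) ^+ #|{: strand s K}| != 0 by rewrite expf_neq0.
have C0 : (N%:R : R[i]) ^+ (\sum_e #|cycles (pr (M e))|) != 0 by rewrite expf_neq0.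
have n0 : (N%:R : R[i]) ^+ n != 0 by rewrite expf_neq0.
exact: cancel_powers.
Qed.

Lemma expectation_fepe :
  let sumM K := \sum_(M : {dffun forall e : edge L, T (npos s K e) (nneg s K e)}) fepe_term M in
  wilson_expectation mu P beta s = (partition_function mu P beta)^-1 * csum sumM
  /\ cabs_summable sumM.
Proof.
move=> sumM; have [] := expectation_series; rewrite /=.
rewrite (_ : (fun K => cintegral _ _) = sumM)//; apply/funext => K.
rewrite weight_termE cintegralZ; last exact: bmeas_prod_trace.
rewrite (cintegral_prod_trace N_gt0 _ _ moment) mulr_sumr.
by apply: eq_bigr => M _; rewrite fepe_termE.
Qed.

End Terms.
End Expansion.

(** * The two gauge groups *)

(** The moment formula for SO(N) has no conjugations; entries being real, they may
    be inserted on any of the factors. *)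
Lemma moment_SO (R : realType) (N : nat) (mu : probability (gauge_group R SO N) R)
    (Wg : forall k, matching k -> R[i]) : is_weingarten_SO mu Wg ->
  forall a b (i j : {ffun 'I_(a + b) -> 'I_N}),
  cintegral mu (edge_entry i j) = \sum_(m : matching (a + b)) Wg (a + b)%N m * rho R m i j.
Proof.
move=> [mom _ _] a b i j; rewrite -[RHS]mom; congr cintegral; apply/funext => U.
by apply: eq_bigr => r _; case: ifP => // _; rewrite conj_gmx_SO.
Qed.

Theorem theorem6p88 (R : realType) (L : lattice) (P : {fset loop L})
    (P_rev : forall p, p \in P -> loop_rev p \in P)
    (N : nat) (N_ge1 : (1 <= N)%N) (beta : R) (beta_gt0 : 0 < beta)
    (n : nat) (s : n.-tuple (loop L))
    (muSU : probability (gauge_group R SU N) R) (haarSU : is_haar muSU)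
    (muSO : probability (gauge_group R SO N) R) (haarSO : is_haar muSO)
    (WgSU : forall a b, walled_matching a b -> R[i])
    (weingartenSU : is_weingarten_SU muSU WgSU)
    (WgSO : forall k, matching k -> R[i])
    (weingartenSO : is_weingarten_SO muSO WgSO) :
  let sumSU (K : {ffun P -> nat}) : R[i] :=
    \sum_(M : fepe_SU s K) fepe_SU_term N beta WgSU M in
  let sumSO (K : {ffun P -> nat}) : R[i] :=
    \sum_(M : fepe_SO s K) fepe_SO_term N beta WgSO M in
  [/\ wilson_expectation muSU P beta s
        = (partition_function muSU P beta)^-1 * csum sumSU,
      wilson_expectation muSO P beta s
        = (partition_function muSO P beta)^-1 * csum sumSO,
      cabs_summable sumSU
    & cabs_summable sumSO].
Proof.
move=> sumSU sumSO.
have [eSU aSU] := expectation_fepe (N := N) (T := fun a b => walled_matching a b)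
  (pr := fun a b (m : walled_matching a b) => val m) (W := WgSU)
  N_ge1 P s beta (weingarten_SU_moment weingartenSU).
have [eSO aSO] := expectation_fepe (N := N) (T := fun a b => matching (a + b))
  (pr := fun a b (m : matching (a + b)) => m) (W := fun a b => WgSO (a + b)%N)
  N_ge1 P s beta (moment_SO weingartenSO).
by split.
Qed.
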